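(* Let $f:\mathbb{R}^d\to\mathbb{R}$ be lower bounded by $f^*>-\infty$ and $(L_0,L_1)$-smooth, and let the unbiased gradient estimates $\nabla f(x,\xi)$ be heavy-tailed with parameters $\kappa\in(1,2]$ and $\vec\sigma\in\mathbb{R}^d_{\ge0}$. Let $\Delta=f(x^1)-f^*$. Then the M-SignSGD algorithm requires the following number $T$ of iterations to achieve $\frac1T\sum_{k=1}^T\mathbb{E}\left[\|\nabla f(x^k)\|_1\right]\le\varepsilon$. **Optimal tuning.** With $\beta_k\equiv1-\min\left\{1,\left(\frac{\Delta L_1\sqrt d}{T\|\vec\sigma\|_\kappa}\right)^{\frac{\kappa}{2\kappa-1}}\right\}$, $\gamma_k\equiv\frac{1-\beta_k}{8}\frac{1}{L_1d}$ if $\varepsilon\ge\frac{3L_0}{L_1}$, and with $\beta_k\equiv1-\min\left\{1,\left(\frac{\Delta L_0}{T\|\vec\sigma\|_\kappa^2}\right)^{\frac{\kappa}{3\kappa-2}}\right\}$, $\gamma_k\equiv\sqrt{\frac{\Delta(1-\beta_k)}{TL_0d}}$ if $\varepsilon\le\frac{3L_0}{L_1}$: $$T=O\left(\left(\frac{\Delta L_0d}{\varepsilon^2}+\frac{\Delta L_1d}{\varepsilon}\right)\left(1+\left(\frac{\sqrt d\,\|\vec\sigma\|_\kappa}{\varepsilon}\right)^{\frac{\kappa}{\kappa-1}}\right)\right).$$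
   Context: Notation: $\|\cdot\|_p$ is the $\ell_p$-norm on $\mathbb{R}^d$; $\mathrm{sign}$ of a vector is taken element-wise; $O(\cdot)$ hides numerical constants. $(L_0,L_1)$-smoothness ($L_0,L_1\ge0$): $f$ is differentiable and for all $x,y\in\mathbb{R}^d$, $\|\nabla f(x)-\nabla f(y)\|_2\le\left(L_0+L_1\sup_{u\in[x,y]}\|\nabla f(u)\|_2\right)\|x-y\|_2$, where $[x,y]$ is the segment between $x$ and $y$. Heavy-tailed gradient estimates: one can sample $\xi$ and compute $\nabla f(x,\xi)\in\mathbb{R}^d$ such that for all $x\in\mathbb{R}^d$ and $i\in\{1,\dots,d\}$, $\mathbb{E}_\xi[\nabla f(x,\xi)]=\nabla f(x)$ and $\mathbb{E}_\xi[|\nabla f(x,\xi)_i-\nabla f(x)_i|^\kappa]\le\sigma_i^\kappa$, with $\vec\sigma=[\sigma_1,\dots,\sigma_d]$ non-negative. M-SignSGD: given a starting point $x^1\in\mathbb{R}^d$, number of iterations $T$, stepsizes $\{\gamma_k\}_{k=1}^T$ and momentums $\{\beta_k\}_{k=1}^T$, with $m^0=0$; for $k=1,\dots,T$ draw an independent sample $\xi^k$, compute $m^k=\beta_km^{k-1}+(1-\beta_k)\nabla f(x^k,\xi^k)$ and set $x^{k+1}=x^k-\gamma_k\,\mathrm{sign}(m^k)$. One stochastic gradient is used per iteration.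
   Formalization: The numerical constant hidden in O(·) is also allowed inside the base of the power κ/(κ−1), so for fixed κ the prefactor may depend on κ; with a constant uniform in κ∈(1,2] the claim fails as κ→1 (d=1, L1=0, ‖σ‖=0.9ε). *)

(* Defs.v *)
From HB Require Import structures.
From mathcomp Require Import all_boot all_order all_algebra.
From mathcomp Require Import all_classical all_reals all_analysis.
Import Order.TTheory GRing.Theory Num.Theory.
Import numFieldNormedType.Exports.

Set Implicit Arguments.
Unset Strict Implicit.
Unset Printing Implicit Defensive.

Local Open Scope classical_set_scope.
Local Open Scope ring_scope.

Definition lp_norm {R : realType} {d : nat} (p : R) (v : 'rV[R]_d) : R :=
  (\sum_i `|v 0 i| `^ p) `^ p^-1.

Definition grad {R : realType} {d : nat} (f : 'rV[R]_d -> R) (x : 'rV[R]_d) :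
    'rV[R]_d :=
  \row_i 'D_(delta_mx 0 i) f x.

Definition segment {R : realType} {d : nat} (x y : 'rV[R]_d) : set 'rV[R]_d :=
  [set x + t *: (y - x) | t in `[0, 1]].

(* The supremum is taken in the extended reals, so that the inequality carries
   no information where the gradient is unbounded on the segment and L1 > 0;
   for L1 = 0 it is L0-Lipschitz continuity of the gradient, as 0 * +oo = 0. *)
Definition L0L1_smooth {R : realType} {d : nat} (L0 L1 : R)
    (f : 'rV[R]_d -> R) : Prop :=
  [/\ 0 <= L0, 0 <= L1, (forall x, differentiable f x) &
    forall x y : 'rV[R]_d,
      ((lp_norm 2 (grad f x - grad f y)%R)%:E <=
        (L0%:E + L1%:E * ereal_sup [set (lp_norm 2 (grad f u))%:E
                                   | u in segment x y])
        * (lp_norm 2 (x - y)%R)%:E)%E].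

(* D is the law of xi and g x xi is the stochastic gradient at x.  No joint
   measurability in (x, xi) is required: the iterates of the algorithm take
   finitely many values. *)
Definition heavy_tailed_estimates {R : realType} {d : nat}
    {dX : measure_display} {Xi : measurableType dX} (D : probability Xi R)
    (f : 'rV[R]_d -> R) (g : 'rV[R]_d -> Xi -> 'rV[R]_d)
    (kappa : R) (sigma : 'rV[R]_d) : Prop :=
  forall (x : 'rV[R]_d) (i : 'I_d),
    [/\ D.-integrable setT (fun z => (g x z 0 i)%:E),
        ('E_D[fun z => (g x z 0 i)%R] = (grad f x 0 i)%R%:E)%E &
        ('E_D[fun z => (`|g x z 0 i - grad f x 0 i| `^ kappa)%R]
           <= (sigma 0 i `^ kappa)%R%:E)%E].

Definition iid_samples {R : realType}
    {dO : measure_display} {Om : measurableType dO} (P : probability Om R)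
    {dX : measure_display} {Xi : measurableType dX} (D : probability Xi R)
    (T : nat) (xi : nat -> Om -> Xi) : Prop :=
  (forall k, (1 <= k <= T)%N ->
     measurable_fun setT (xi k) /\
     forall A : set Xi, measurable A -> P (xi k @^-1` A) = D A) /\
  (forall (J : seq nat) (A : nat -> set Xi),
     uniq J -> (forall k, k \in J -> (1 <= k <= T)%N) ->
     (forall k, measurable (A k)) ->
     P (\bigcap_(k in [set` J]) (xi k @^-1` A k)) =
       (\prod_(k <- J) P (xi k @^-1` A k))%E).

(* The pair (x^{k+1}, m^k). *)
Fixpoint msignsgd_state {R : realType} {d : nat} {Xi : Type}
    (g : 'rV[R]_d -> Xi -> 'rV[R]_d) (x1 : 'rV[R]_d) (beta gamma : nat -> R)
    (xi : nat -> Xi) (k : nat) : 'rV[R]_d * 'rV[R]_d :=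
  if k is k'.+1 then
    let: (x, m) := msignsgd_state g x1 beta gamma xi k' in
    let m' := beta k *: m + (1 - beta k) *: g x (xi k) in
    (x - gamma k *: map_mx Num.sg m', m')
  else (x1, 0).

(* x^k for k >= 1. *)
Definition msignsgd_iterate {R : realType} {d : nat} {Xi : Type}
    (g : 'rV[R]_d -> Xi -> 'rV[R]_d) (x1 : 'rV[R]_d) (beta gamma : nat -> R)
    (xi : nat -> Xi) (k : nat) : 'rV[R]_d :=
  (msignsgd_state g x1 beta gamma xi k.-1).1.

Definition mean_grad_norm {R : realType} {d : nat}
    {dO : measure_display} {Om : measurableType dO} (P : probability Om R)
    {Xi : Type} (f : 'rV[R]_d -> R) (g : 'rV[R]_d -> Xi -> 'rV[R]_d)
    (x1 : 'rV[R]_d) (beta gamma : nat -> R) (xi : nat -> Om -> Xi)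
    (T : nat) : \bar R :=
  ((T%:R^-1)%:E * \sum_(1 <= k < T.+1)
     'E_P[fun w => lp_norm 1 (grad f
            (msignsgd_iterate g x1 beta gamma (fun j => xi j w) k))])%E.

(* min {1, (a / b) ^ p}, where a / 0 stands for +oo. *)
Definition capped_ratio {R : realType} (a b p : R) : R :=
  if b == 0 then 1 else Num.min 1 ((a / b) `^ p).

(* Tuning for eps >= 3 L0 / L1. *)
Definition beta_large {R : realType} {d : nat} (Delta L1 : R)
    (sigma : 'rV[R]_d) (kappa : R) (T : nat) : R :=
  1 - capped_ratio (Delta * L1 * Num.sqrt d%:R) (T%:R * lp_norm kappa sigma)
        (kappa / (2 * kappa - 1)).

Definition gamma_large {R : realType} (d : nat) (beta L1 : R) : R :=
  (1 - beta) / 8 * (L1 * d%:R)^-1.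

(* Tuning for eps <= 3 L0 / L1. *)
Definition beta_small {R : realType} {d : nat} (Delta L0 : R)
    (sigma : 'rV[R]_d) (kappa : R) (T : nat) : R :=
  1 - capped_ratio (Delta * L0) (T%:R * lp_norm kappa sigma ^+ 2)
        (kappa / (3 * kappa - 2)).

Definition gamma_small {R : realType} (d : nat) (Delta beta L0 : R)
    (T : nat) : R :=
  Num.sqrt (Delta * (1 - beta) / (T%:R * L0 * d%:R)).

(* The single numerical constant C rescales both the leading term and the base
   of the power.  A factor in front only, independent of kappa, would be too
   small as kappa tends to 1, since kappa / (kappa - 1) is then unbounded.  For
   a fixed kappa, this bound is at most C * max {1, C ^ (kappa / (kappa - 1))}
   times the same expression without constants. *)
Definition iteration_bound {R : realType} (d : nat) (C Delta L0 L1 eps : R)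
    (sigma : 'rV[R]_d) (kappa : R) : R :=
  C * (Delta * L0 * d%:R / eps ^+ 2 + Delta * L1 * d%:R / eps)
    * (1 + (C * (Num.sqrt d%:R * lp_norm kappa sigma / eps))
             `^ (kappa / (kappa - 1))).

(* Main.v *)
(* Smoothness gives, for a step x' = x - gamma sign(m),
     f x' <= f x - gamma |grad f x|_1 + 2 gamma |m - grad f x|_1
             + O(d gamma^2 (L0 + L1 |grad f x|_1)),
   so the average of |grad f x^k|_1 is controlled by the errors m^k - grad f x^k.
   Such an error is the sum of a drift, which collects the discounted initial
   gradient and the discounted increments of grad f along the path, and of a
   noise N^k = beta N^(k-1) + (1 - beta) (g(x^k, xi^k) - grad f x^k).
   The drift is bounded pathwise, the initial gradient in terms of Delta by one
   virtual sign step from x1.  As the noise only has moments of order kappa, we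
   follow E[h(N^k_i)] for h(u) = sqrt(tau^2 + u^2): since h' is bounded,
     h(u + v) <= h(u) + h'(u) v + 2 tau (|v| / tau)^kappa,
   where the middle term has mean zero, and
   h(beta u) <= beta h(u) + (1 - beta) tau.
   The smoothness assumption says nothing on a segment where the gradient is
   unbounded; a Baire argument shows that there is no such segment. *)

(* Both tunings rest on one pair of estimates. Write [lam] for Delta L1 d / eps or Delta L0 d /
   eps^2, alpha = 1 - beta, and s = sqrt d |sigma|_kappa / eps. A bound on T with the constant c^2
   gives lam / (T alpha) <= c^-2 and (alpha s)^kappa <= alpha c^-kappa. The first controls the
   initial gap and the initial gradient; the second makes the mean noise a small multiple of eps. As
   m^0 = 0, the initial gradient enters with total weight at most min(T, 1/alpha). The virtual step
   bounds it by eps (1/18 + 28 lam): the constant part may be counted T times, the part with [lam]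
   only 1/alpha times. Measurability is an obstacle: g is measurable in xi only for each fixed x.
   The iterates take finitely many values, which makes g(x^k, xi^k) measurable, and the new sample
   is integrated out by Tonelli on the product of Xi with the sample space carrying the
   sigma-algebra of the past. If Delta = 0 or L0 = 0, the prescribed stepsize can be 0; the iterates
   then never move, and the gradient at x1 is bounded directly. *)
Require Import Defs.
From HB Require Import structures.
From mathcomp Require Import all_boot all_order all_algebra.
From mathcomp Require Import all_classical all_reals all_analysis.
From mathcomp Require Import measurable_realfun.
From mathcomp Require Import ring lra.
Import Order.TTheory GRing.Theory Num.Theory.
Import numFieldNormedType.Exports.

Set Implicit Arguments.
Unset Strict Implicit.
Unset Printing Implicit Defensive.

Local Open Scope classical_set_scope.
Local Open Scope ring_scope.

(** * Norms *)

(* Locked, as unification would otherwise unfold the real powers. *)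
HB.lock Definition norm1 {R : realType} {d : nat} (v : 'rV[R]_d) : R :=
  \sum_i `|v 0 i|.

HB.lock Definition norm2 {R : realType} {d : nat} (v : 'rV[R]_d) : R :=
  lp_norm 2 v.

Section LpNorms.
Context {R : realType} {d : nat}.
Implicit Types u v w : 'rV[R]_d.

Lemma coordN v i : (- v) 0 i = - v 0 i. Proof. by rewrite mxE. Qed.

Lemma coordD u v i : (u + v) 0 i = u 0 i + v 0 i. Proof. by rewrite mxE. Qed.

Lemma coordB u v i : (u - v) 0 i = u 0 i - v 0 i.
Proof. by rewrite coordD coordN. Qed.

Lemma coordZ (a : R) v i : (a *: v) 0 i = a * v 0 i.
Proof. by rewrite mxE. Qed.

Lemma coord_sg v i : (map_mx Num.sg v) 0 i = Num.sg (v 0 i).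
Proof. by rewrite mxE. Qed.

Lemma lp_norm1E v : lp_norm 1 v = norm1 v.
Proof.
rewrite norm1.unlock /lp_norm invr1 powRr1.
  by apply: eq_bigr => i _; rewrite powRr1.
by apply: sumr_ge0 => i _; exact: powR_ge0.
Qed.

Lemma lp_norm2E v : lp_norm 2 v = norm2 v. Proof. by rewrite norm2.unlock. Qed.

Lemma norm1E v : norm1 v = \sum_i `|v 0 i|. Proof. by rewrite norm1.unlock. Qed.

Lemma norm1_ge0 v : 0 <= norm1 v.
Proof. by rewrite norm1E sumr_ge0. Qed.

Lemma norm2_ge0 v : 0 <= norm2 v.
Proof. by rewrite norm2.unlock; exact: powR_ge0. Qed.

Lemma norm2_sqr v : norm2 v ^+ 2 = \sum_i v 0 i ^+ 2.
Proof.
rewrite norm2.unlock /lp_norm -powR_mulrn ?powR_ge0// -powRrM mulVf// powRr1.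
  by apply: eq_bigr => i _; rewrite (powR_mulrn 2)// real_normK ?num_real.
by apply: sumr_ge0 => i _; exact: powR_ge0.
Qed.

Lemma norm2_le v (a : R) : 0 <= a -> \sum_i v 0 i ^+ 2 <= a ^+ 2 ->
  norm2 v <= a.
Proof. by move=> a0; rewrite -norm2_sqr ler_sqr ?nnegrE ?norm2_ge0. Qed.

Lemma norm2N v : norm2 (- v) = norm2 v.
Proof.
apply/eqP; rewrite -(@eqrXn2 _ 2) ?norm2_ge0//; apply/eqP.
by rewrite !norm2_sqr; apply: eq_bigr => i _; rewrite mxE sqrrN.
Qed.

Lemma norm2_0 : norm2 (0 : 'rV[R]_d) = 0.
Proof.
apply: le_anti; rewrite norm2_ge0 andbT; apply: norm2_le => //.
by rewrite expr0n big1// => i _; rewrite mxE expr0n.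
Qed.

Lemma norm2Z (a : R) v : norm2 (a *: v) = `|a| * norm2 v.
Proof.
apply/eqP; rewrite -(@eqrXn2 _ 2) ?mulr_ge0 ?norm2_ge0//; apply/eqP.
rewrite [RHS]exprMn (norm2_sqr v) (norm2_sqr (a *: v)) mulr_sumr.
by apply: eq_bigr => i _; rewrite mxE exprMn (real_normK (num_real a)).
Qed.

Lemma ler_coord_norm2 v i : `|v 0 i| <= norm2 v.
Proof.
rewrite -ler_sqr ?nnegrE ?norm2_ge0// norm2_sqr real_normK ?num_real//.
by rewrite (bigD1 i)//= lerDl sumr_ge0// => j _; exact: sqr_ge0.
Qed.

Lemma norm2_eq0 v : norm2 v = 0 -> v = 0.
Proof.
move=> v0; apply/rowP => i; apply/eqP; rewrite mxE -normr_le0 -v0.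
exact: ler_coord_norm2.
Qed.

Lemma cauchy_schwarz u v : \sum_i u 0 i * v 0 i <= norm2 u * norm2 v.
Proof.
have [/norm2_eq0 ->|u0] := eqVneq (norm2 u) 0.
  by rewrite norm2_0 mul0r big1// => i _; rewrite mxE mul0r.
have [/norm2_eq0 ->|v0] := eqVneq (norm2 v) 0.
  by rewrite norm2_0 mulr0 big1// => i _; rewrite mxE mulr0.
have {}u0 : 0 < norm2 u by rewrite lt_neqAle eq_sym u0 norm2_ge0.
have {}v0 : 0 < norm2 v by rewrite lt_neqAle eq_sym v0 norm2_ge0.
have : \sum_i v 0 i ^+ 2 = norm2 v ^+ 2 by rewrite norm2_sqr.
have : \sum_i u 0 i ^+ 2 = norm2 u ^+ 2 by rewrite norm2_sqr.
move: (norm2 u) (norm2 v) u0 v0 => a b a0 b0 ua vb.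
have -> : a * b = \sum_i (b / a / 2 * u 0 i ^+ 2 + a / b / 2 * v 0 i ^+ 2).
  by rewrite big_split/= -!mulr_sumr ua vb; field; rewrite !gt_eqF.
apply: ler_sum => i _; rewrite -subr_ge0; move: (u 0 i) (v 0 i) => x y.
have -> : b / a / 2 * x ^+ 2 + a / b / 2 * y ^+ 2 - x * y =
    (b * x - a * y) ^+ 2 / (2 * a * b) by field; rewrite !gt_eqF.
by rewrite divr_ge0 ?sqr_ge0// !mulr_ge0// ltW.
Qed.

Lemma cauchy_schwarz_norm u v :
  `|\sum_i u 0 i * v 0 i| <= norm2 u * norm2 v.
Proof.
rewrite ler_norml cauchy_schwarz andbT lerNl -sumrN -(norm2N u).
apply: le_trans (cauchy_schwarz _ _); apply: ler_sum => i _.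
by rewrite mxE mulNr.
Qed.

Lemma norm2D u v : norm2 (u + v) <= norm2 u + norm2 v.
Proof.
apply: norm2_le; first by rewrite addr_ge0 ?norm2_ge0.
have uv := cauchy_schwarz u v.
rewrite sqrrD (norm2_sqr u) (norm2_sqr v).
under eq_bigr do rewrite mxE sqrrD.
by rewrite 2!big_split/= sumrMnl lerD2r lerD2l lerMn2r.
Qed.

Lemma norm2_le1 v : norm2 v <= norm1 v.
Proof.
apply: norm2_le; first exact: norm1_ge0.
rewrite expr2 norm1E mulr_suml; apply: ler_sum => i _.
rewrite -(real_normK (num_real _)) expr2 ler_wpM2l//.
by rewrite (bigD1 i)//= lerDl sumr_ge0.
Qed.

Lemma norm1_le2 v : norm1 v <= Num.sqrt d%:R * norm2 v.
Proof.
have := cauchy_schwarz (const_mx 1) (map_mx Num.norm v).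
rewrite norm1E; under eq_bigr do rewrite !mxE mul1r.
move=> /le_trans; apply; apply: ler_pM; rewrite ?norm2_ge0//; apply: norm2_le.
- exact: sqrtr_ge0.
- rewrite sqr_sqrtr//; under eq_bigr do rewrite mxE expr1n.
  by rewrite sumr_const card_ord.
- exact: norm2_ge0.
- rewrite norm2_sqr le_eqVlt; apply/orP; left; apply/eqP/eq_bigr => i _.
  by rewrite mxE real_normK ?num_real.
Qed.

Lemma norm1D u v : norm1 (u + v) <= norm1 u + norm1 v.
Proof.
rewrite !norm1E -big_split/=; apply: ler_sum => i _.
by rewrite mxE ler_normD.
Qed.

Lemma norm1Z (a : R) v : norm1 (a *: v) = `|a| * norm1 v.
Proof.
by rewrite !norm1E mulr_sumr; apply: eq_bigr => i _; rewrite mxE normrM.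
Qed.

Lemma norm2_le_norm v : norm2 v <= d%:R * `|v|.
Proof.
apply: (le_trans (norm2_le1 v)); rewrite norm1E.
rewrite mulr_natl -[X in _ *+ X]card_ord -sumr_const.
apply: ler_sum => i _; rewrite [leRHS]/Num.norm/= mx_normrE.
by apply/bigmax_geP; right; exists (ord0, i).
Qed.

Lemma norm_mx_coord v : v != 0 -> exists i, `|v| = `|v 0 i|.
Proof.
move=> v0; have [[j i] /= vE] : exists i, mx_norm v = `|v i.1 i.2|.
  by apply: mx_norm_neq0; move: v0; apply: contraNneq => /mx_norm_eq0/eqP.
by exists i; rewrite -(ord1 j) -vE.
Qed.

Lemma norm_le_norm2 v : `|v| <= norm2 v.
Proof.
have [->|/norm_mx_coord[i ->]] := eqVneq v 0; last exact: ler_coord_norm2.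
by rewrite normr0 norm2_ge0.
Qed.

Lemma norm2_delta_le1 i : norm2 (delta_mx 0 i : 'rV[R]_d) <= 1.
Proof.
apply: norm2_le => //; rewrite (bigD1 i)//= big1 => [|j ji].
  by rewrite mxE !eqxx addr0.
by rewrite mxE (negbTE ji) andbF expr0n.
Qed.

End LpNorms.

(** * Smooth functions have locally bounded gradients *)

Section DifferentiableFunction.
Context {R : realType} {d : nat} (f : 'rV[R]_d -> R).
Hypothesis df : forall x, differentiable f x.
Implicit Types x y h : 'rV[R]_d.

Lemma derive_grad x h : 'D_h f x = \sum_i grad f x 0 i * h 0 i.
Proof.
rewrite deriveE// [in LHS](row_sum_delta h) linear_sum/=.
by apply: eq_bigr => i _; rewrite linearZ/= mxE deriveE// mulrC.
Qed.

Lemma is_derive_line x h (t : R) :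
  is_derive t 1 (fun s => f (x + s *: h))
    (\sum_i grad f (x + t *: h) 0 i * h 0 i).
Proof.
rewrite -derive_grad.
have E : (fun s : R => s^-1 *: (((fun s => f (x + s *: h)) \o shift t) (s *: 1)
      - f (x + t *: h))) =
    (fun s : R => s^-1 *: ((f \o shift (x + t *: h)) (s *: h) - f (x + t *:
      h))).
  apply/funext => s /=; congr (_ *: (f _ - _)).
  by rewrite [s *: 1]mulr1 scalerDl addrCA.
split; last by rewrite /derive E.
by rewrite /derivable E; apply: diff_derivable.
Qed.

Lemma mvt_line x h : exists2 t : R, 0 <= t <= 1 &
  f (x + h) - f x = \sum_i grad f (x + t *: h) 0 i * h 0 i.
Proof.
pose phi (s : R) := f (x + s *: h).
have dphi (s : R) : is_derive s 1 phi (\sum_i grad f (x + s *: h) 0 i * h 0 i).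
  exact: is_derive_line.
have [|t] := @MVT_segment R phi
    (fun t => \sum_i grad f (x + t *: h) 0 i * h 0 i) 0 1 ler01.
- apply: continuous_subspaceT => s; apply: differentiable_continuous.
  by apply/derivable1_diffP; apply: ex_derive.
- rewrite in_itv/= => t01 /=; rewrite subr0 mulr1 /phi scale1r scale0r addr0.
  by exists t.
Qed.

Lemma differentiable_locally_lipschitz x :
  exists K s : R, [/\ 0 <= K, 0 < s &
    forall h, `|h| < s -> `|f (x + h) - f x| <= K * `|h|].
Proof.
have := diff_locallyx (df x).
set k := 'o _ => fE.
have /(littleoP [littleo of k])/nbhs_ballP[s s0 ks] : (0 : R) < 1 by [].
exists (norm2 (grad f x) * d%:R + 1), s; split => // [|h hs].
  by rewrite addr_ge0// mulr_ge0// norm2_ge0.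
rewrite (addrC x) fE addrC !addrA addNr add0r mulrDl.
apply: (le_trans (ler_normD _ _)); apply: lerD; last first.
  by apply: ks; rewrite -ball_normE/= sub0r normrN.
rewrite -deriveE// derive_grad -mulrA; apply: le_trans (_ : norm2 (grad f x) *
  norm2 h <= _).
  exact: cauchy_schwarz_norm.
by apply: ler_wpM2l; [exact: norm2_ge0|exact: norm2_le_norm].
Qed.

Definition grad_bounded_near x :=
  exists M : R, \forall y \near x, norm2 (grad f y) <= M.

Lemma compact_grad_bounded (K : set 'rV[R]_d) : compact K ->
  (forall x, K x -> grad_bounded_near x) ->
  exists M : R, forall x, K x -> norm2 (grad f x) <= M.
Proof.
move=> /compact_near_coveringP cK Kb.
have [|M [_ MK]] := cK _ +oo%R (fun (M : R) x => norm2 (grad f x) <= M) _.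
  move=> x /Kb[M fM]; near=> y M' => /=.
  apply: (@le_trans _ _ M); first by near: y.
  by near: M'; apply: nbhs_pinfty_ge; exact: num_real.
exists (M + 1); apply: MK.
by rewrite ltrDl.
Unshelve. all: by end_near. Qed.

Lemma compact_segment x y : compact (segment x y).
Proof.
apply: (@continuous_compact _ _ (fun t : R => x + t *: (y - x)) `[0, 1]).
  apply: continuous_subspaceT => t.
  by apply: cvgD; [exact: cvg_cst|apply: cvgZr_tmp; exact: cvg_id].
exact: segment_compact.
Qed.

End DifferentiableFunction.

Section Smooth.
Context {R : realType} {d : nat} (f : 'rV[R]_d -> R) (L0 L1 : R).
Hypothesis smooth_f : L0L1_smooth L0 L1 f.
Implicit Types x y h : 'rV[R]_d.

Let L0_ge0 : 0 <= L0. Proof. by case: smooth_f. Qed.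
Let L1_ge0 : 0 <= L1. Proof. by case: smooth_f. Qed.
Let df x : differentiable f x. Proof. by case: smooth_f. Qed.

Lemma segment_left x y : segment x y x.
Proof. by exists 0; rewrite ?scale0r ?addr0//= in_itv/= lexx ler01. Qed.

Lemma segment_sub x y (t : R) : 0 <= t <= 1 ->
  segment x (x + t *: (y - x)) `<=` segment x y.
Proof.
move=> /andP[t0 t1] u [s /=]; rewrite in_itv/= => /andP[s0 s1] <-.
exists (s * t); last by rewrite addrAC subrr add0r scalerA.
by rewrite /= in_itv/= mulr_ge0//= mulr_ile1.
Qed.

Lemma smooth_bounded x y (m : R) :
  (forall u, segment x y u -> norm2 (grad f u) <= m) ->
  norm2 (grad f x - grad f y) <= (L0 + L1 * m) * norm2 (x - y).
Proof.
move=> fm; case: smooth_f => _ _ _ /(_ x y).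
rewrite !lp_norm2E -lee_fin => /le_trans; apply.
rewrite EFinM EFinD EFinM; apply: lee_wpmul2r;
  first by rewrite lee_fin norm2_ge0.
rewrite leeD2l// lee_wpmul2l//.
apply: ge_ereal_sup => _ [u uxy <-].
by rewrite lp_norm2E lee_fin fm.
Qed.

(** With S the supremum of |grad f| on the segment, smoothness gives S <= |grad f x| + (L0 + L1 S)
    |h|, and L1 |h| <= 1/8 lets L1 S be absorbed; hence 8/7 = 1 / (1 - 1/8). Absorption requires S
    finite, and [M] serves only to ensure this. *)
Lemma smooth_close_bounded x h (M : R) :
  (forall u, segment x (x + h) u -> norm2 (grad f u) <= M) ->
  L1 * norm2 h <= 8^-1 ->
  norm2 (grad f (x + h) - grad f x) <=
    8 / 7 * (L0 + L1 * norm2 (grad f x)) * norm2 h.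
Proof.
move=> fM Lh; set y := x + h in fM *.
have yxE : y - x = h by rewrite /y addrAC subrr add0r.
pose A := [set norm2 (grad f u) | u in segment x y].
have A0 : A !=set0 by exists (norm2 (grad f x)); exists x => //;
  exact: segment_left.
have supA : has_sup A by split => //; exists M => _ [u uxy <-]; exact: fM.
have fA u : segment x y u -> norm2 (grad f u) <= sup A.
  by move=> uxy; apply: ub_le_sup; [case: supA|exists u].
have close (t : R) : 0 <= t <= 1 ->
    norm2 (grad f (x + t *: h) - grad f x) <= (L0 + L1 * sup A) * (t * norm2 h).
  move=> /[dup] t01 /andP[t0 _]; rewrite -norm2N opprB.
  have -> : t * norm2 h = norm2 (x - (x + t *: h)).
    by rewrite opprD addrA subrr add0r norm2N norm2Z ger0_norm.
  by apply: smooth_bounded => u; rewrite -yxE => /(segment_sub t01)/fA.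
have h0 := norm2_ge0 h; have G0 := norm2_ge0 (grad f x).
have A_ge0 : 0 <= sup A by apply: le_trans G0 (fA _ (segment_left _ _)).
have LA0 : 0 <= L0 + L1 * sup A by rewrite addr_ge0// mulr_ge0.
have supA_le : sup A <= norm2 (grad f x) + (L0 + L1 * sup A) * norm2 h.
  apply: ge_sup => // _ [_ [t /= + <-] <-]; rewrite in_itv/= yxE => t01.
  have -> : grad f (x + t *: h) = grad f x + (grad f (x + t *: h) - grad f x).
    by rewrite [RHS]addrC subrK.
  apply: (le_trans (norm2D _ _)); rewrite lerD2l.
  apply: le_trans (close _ t01) _; apply: ler_wpM2l => //.
  by case/andP: t01 => _ t1; rewrite ler_piMl.
have := close 1; rewrite scale1r mul1r ler01 lexx => /(_ isT)/le_trans; apply.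
apply: ler_wpM2r => //.
have : L1 * sup A <= L1 * norm2 (grad f x) + (L0 + L1 * sup A) * 8^-1.
  apply: le_trans (ler_wpM2l L1_ge0 supA_le) _.
  rewrite mulrDr lerD2l mulrCA; exact: ler_wpM2l.
move: (L1 * sup A) (L1 * norm2 (grad f x)) => a b; lra.
Qed.

Local Notation bad e := (~ grad_bounded_near f e).

Lemma good_nbhs x : grad_bounded_near f x ->
  exists2 s : R, 0 < s & forall e, bad e -> s <= `|x - e|.
Proof.
move=> [M /near_join/nbhs_ballP[s s0 xs]]; exists s => // e be.
rewrite leNgt; apply/negP => es; apply: be; exists M.
by apply: xs; rewrite -ball_normE.
Qed.

Lemma large_grad_slope x i (N r : R) : 0 < r -> 0 <= N -> N < `|grad f x 0 i| ->
  exists2 h, `|h| <= r & N * `|h| < `|f (x + h) - f x|.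
Proof.
move=> r0 N0 Ni; set v : 'rV[R]_d := delta_mx 0 i.
have v1 : `|v| <= 1 := le_trans (norm_le_norm2 _) (norm2_delta_le1 _).
have v0 : 0 < `|v|.
  rewrite normr_gt0; apply/eqP => /rowP/(_ i); rewrite !mxE !eqxx/= => /eqP.
  by rewrite oner_eq0.
have := @diff_derivable _ _ _ f x v (df x).
rewrite /derivable => /cvg_ex[l fl].
have lE : l = grad f x 0 i by rewrite mxE; apply/esym; exact: cvg_lim.
rewrite -lE in Ni.
have nearN : \forall t \near (0 : R)^',
    N < `|t^-1 *: ((f \o shift x) (t *: v) - f x)|.
  exact: cvgr_norm_gt fl _ Ni.
near (0 : R)^' => t.
exists (t *: v).
  rewrite normrZ; apply: le_trans (_ : `|t| * 1 <= _); first exact: ler_wpM2l.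
  rewrite mulr1; near: t; apply/nbhs_ballP; exists r => //= t.
  by rewrite -ball_normE/= sub0r normrN => /ltW.
have t0 : 0 < `|t| by rewrite normr_gt0; near: t; exact: nbhs_dnbhs_neq.
have : N < `|t^-1 *: ((f \o shift x) (t *: v) - f x)| by near: t.
rewrite /= normrZ normfV mulrC ltr_pdivlMr// (addrC (t *: v)) => H.
by apply: le_lt_trans H; rewrite normrZ; apply: ler_wpM2l => //;
  apply: ler_piMr.
Unshelve. all: by end_near. Qed.

(* Take x near e0 with a large partial derivative of index i and let rho be its
   distance to the bad points.  Between x and y = x + (rho / 2) e_i the gradient
   is nearly constant, so f varies by at least a multiple of rho; both x and y
   are within O(rho) of some bad point e, hence f varies as much between e and
   one of them. *)
Lemma bad_slope e0 (N r : R) : bad e0 -> 0 < r -> 0 <= N ->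
  exists e h, [/\ bad e, `|e - e0| < r, `|h| <= r & N * `|h| < `|f (e + h) - f
    e|].
Proof.
move=> be0 r0 N0; set D : R := d%:R.
have D0 : 0 <= D by [].
(* [K] exceeds [L1] and [L0 + L1 * D]. A step of length at most 1 / (8 K) thus meets the condition
   of [smooth_close_bounded] and, since G <= D p and p >= 1, changes the gradient by at most 8/7 *
   p/8 <= p/2. *)
pose K := L0 + L1 * D + L1 + 1.
have L1D : 0 <= L1 * D by exact: mulr_ge0.
have K0 : 0 < K by rewrite /K; move: L0_ge0 L1_ge0 L1D; lra.
pose s := Num.min (r / 3) (8 * K)^-1.
have s0 : 0 < s by rewrite lt_min divr_gt0// invr_gt0 mulr_gt0.
have sr : s <= r / 3 by rewrite ge_min lexx.
have sK : s * K <= 8^-1.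
  have : s <= (8 * K)^-1 by rewrite ge_min lexx orbT.
  by rewrite invfM -ler_pdivlMr.
(* 18 = 4 (2 + 5/2): the increment of f between x and y exceeds (1 + 18 N) rho / 4, while x and y
   lie within 2 rho and 5/2 rho of the bad point e. *)
pose M := 1 + 18 * N.
have [x xe0 Mx] : exists2 x, `|x - e0| < s & D * M < norm2 (grad f x).
  apply: contrapT => noX; apply: be0; exists (D * M); apply/nbhs_ballP.
  exists s => //= x; rewrite -ball_normE/= distrC => xs.
  by rewrite leNgt; apply/negP => Mx; apply: noX; exists x.
set G := norm2 (grad f x) in Mx.
have DM0 : 0 <= D * M by rewrite mulr_ge0// addr_ge0// mulr_ge0.
have [i Gi] : exists i, G <= D * `|grad f x 0 i|.
  have /norm_mx_coord[i gi] : grad f x != 0.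
    apply: contraTneq Mx => gx0; rewrite -leNgt /G gx0.
    suff -> : norm2 (0 : 'rV[R]_d) = 0 by [].
    exact: norm2_0.
  by exists i; rewrite -gi; exact: norm2_le_norm.
set p := `|grad f x 0 i| in Gi.
have pM : M < p by rewrite ltNge; apply/negP => /(ler_wpM2l D0); lra.
(* A bad x serves as e itself; otherwise its distance to the bad points is positive. *)
have [gx|bx] := pselect (grad_bounded_near f x); last first.
  have [|h hr hN] := @large_grad_slope x i N r r0 N0.
    by apply: le_lt_trans pM; rewrite /M; lra.
  by exists x, h; split => //; apply: lt_le_trans xe0 _; lra.
have [t t0 tx] := good_nbhs gx.
pose A := (fun e => `|x - e|) @` [set e | bad e].
have A0 : A `|x - e0| by exists e0.
have lbA : lbound A t by move=> _ [e /= be <-]; exact: tx.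
have infA : has_inf A by split; [exists `|x - e0| | exists t].
set rho := inf A.
have rho0 : 0 < rho by apply: lt_le_trans t0 _; apply: lb_le_inf => //;
  exists `|x - e0|.
have rhos : rho <= s.
  by apply: ltW; apply: le_lt_trans (xe0); apply: ge_inf => //; exists t.
(* The tolerance is rho itself, whence |x - e| < 2 rho. *)
have [_ [e /= be <-] exrho] := inf_adherent rho0 infA.
rewrite -/rho in exrho.
pose v : 'rV[R]_d := delta_mx 0 i.
have v1 := norm2_delta_le1 i : norm2 v <= 1.
have normZv (a : R) : 0 <= a -> norm2 (a *: v) <= a.
  by move=> a0; rewrite norm2Z ger0_norm// ler_piMr.
have rho2_ge0 : 0 <= rho / 2 by lra.
have good_line u : `|x - u| < rho -> grad_bounded_near f u.
  move=> ux; apply: contrapT => bu; have : rho <= `|x - u|.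
    by apply: ge_inf; [exists t|exists u].
  by rewrite leNgt ux.
(* Going only half the distance rho keeps the whole segment away from bad points, so the gradient is
   bounded on it by compactness. *)
have [|M' fM'] := compact_grad_bounded (f := f) (@compact_segment _ _ x (x +
  (rho / 2) *: v)).
  move=> u [a /=]; rewrite in_itv/= => /andP[a0 a1] <-; apply: good_line.
  rewrite opprD addrA subrr add0r normrN (addrAC x) subrr add0r scalerA.
  apply: le_lt_trans (norm_le_norm2 _) _; apply: le_lt_trans (normZv _ _) _.
    by rewrite mulr_ge0// ltW// divr_gt0.
  apply: le_lt_trans (_ : 1 * (rho / 2) < _); first by rewrite ler_wpM2r//; lra.
  lra.
have [a /andP[a0 a1]] := mvt_line df x ((rho / 2) *: v).
rewrite (bigD1 i)//= big1 => [|j ji]; last by rewrite !mxE (negbTE ji) andbF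
  !mulr0.
have vi : ((rho / 2) *: v) 0 i = rho / 2 by rewrite !mxE !eqxx mulr1.
rewrite addr0 vi scalerA => fxy.
set b := a * (rho / 2) in fxy.
have b0 : 0 <= b by rewrite mulr_ge0// ltW// divr_gt0.
have brho : b <= rho / 2 by rewrite ler_piMl//; lra.
have bK : b * K <= 8^-1.
  by apply: le_trans sK; rewrite ler_wpM2r ?(ltW K0)//; lra.
have L0b : L0 * b <= b * K by rewrite mulrC ler_wpM2l// /K; move: L1_ge0; lra.
have L1b : L1 * b <= b * K by rewrite mulrC ler_wpM2l// /K; move: L0_ge0; lra.
have LDb : (L0 + L1 * D) * b <= b * K.
  by rewrite mulrC ler_wpM2l// /K; move: L1_ge0; lra.
have p1 : 1 <= p by move: pM; rewrite /M; lra.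
have close : `|grad f (x + b *: v) 0 i - grad f x 0 i| <= p / 2.
  apply: le_trans (_ : 8 / 7 * ((L0 + L1 * G) * b) <= _).
    rewrite mulrA.
    have -> : grad f (x + b *: v) 0 i - grad f x 0 i =
        (grad f (x + b *: v) - grad f x) 0 i by rewrite !mxE.
    apply: le_trans (ler_coord_norm2 _ _) _.
    apply: (@le_trans _ _ (8 / 7 * (L0 + L1 * G) * norm2 (b *: v))).
      apply: (@smooth_close_bounded _ _ M') => [u ub|].
        apply: fM'.
        have := @segment_sub x (x + (rho / 2) *: v) a.
        by rewrite addrAC subrr add0r scalerA -/b a0 a1 => /(_ isT); exact.
      by apply: le_trans (ler_wpM2l L1_ge0 (normZv _ b0)) _;
        exact: le_trans L1b bK.
    apply: ler_wpM2l (normZv _ b0).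
    by rewrite mulr_ge0// addr_ge0// mulr_ge0// norm2_ge0.
  have : (L0 + L1 * G) * b <= (L0 + L1 * D) * b * p.
    rewrite mulrAC ler_wpM2r// mulrDl; apply: lerD; first exact: ler_peMr.
    by rewrite -mulrA ler_wpM2l.
  have : (L0 + L1 * D) * b * p <= 8^-1 * p.
    by rewrite ler_wpM2r ?normr_ge0//; exact: le_trans LDb bK.
  move: ((L0 + L1 * G) * b) ((L0 + L1 * D) * b * p) => u w; lra.
have fxy_ge : p / 4 * rho <= `|f (x + (rho / 2) *: v) - f x|.
  rewrite fxy normrM (ger0_norm (_ : 0 <= rho / 2)) ?divr_ge0 ?(ltW rho0)//.
  have : p / 2 <= `|grad f (x + b *: v) 0 i|.
    move: close; rewrite distrC => /(le_trans (lerB_dist _ _)).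
    by rewrite -/p; lra.
  move=> /(ler_wpM2r (ltW rho0)); lra.
have [fxe|fxe] := ltP (N * `|x - e|) (`|f x - f e|).
  exists e, (x - e); split => //; last by rewrite (addrC e) subrK.
    have := ler_distD x e e0; rewrite (distrC e x); lra.
  lra.
exists e, (x - e + (rho / 2) *: v); split => //.
- have := ler_distD x e e0; rewrite (distrC e x); lra.
- apply: le_trans (ler_normD _ _) _.
  have := le_trans (norm_le_norm2 _) (normZv _ rho2_ge0); lra.
have -> : e + (x - e + (rho / 2) *: v) = x + (rho / 2) *: v.
  by rewrite addrA [e + _]addrC subrK.
have hle : `|x - e + (rho / 2) *: v| <= 5 / 2 * rho.
  apply: le_trans (ler_normD _ _) _.
  have := le_trans (norm_le_norm2 _) (normZv _ rho2_ge0); lra.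
have tri : `|f (x + (rho / 2) *: v) - f x| <=
    `|f (x + (rho / 2) *: v) - f e| + `|f x - f e|.
  by have := ler_distD (f e) (f (x + (rho / 2) *: v)) (f x);
    rewrite (distrC (f e)).
have Nh := ler_wpM2l N0 hle.
have Nxe : N * `|x - e| <= N * (2 * rho) by apply: ler_wpM2l => //; lra.
have : (1 + 18 * N) / 4 * rho < p / 4 * rho by rewrite ltr_pM2r// ltr_pM2r.
lra.
Qed.

End Smooth.

Section SmoothNoBadPoint.
Context {R : realType} {d : nat} (f : 'rV[R]_d -> R) (L0 L1 : R).
Hypothesis smooth_f : L0L1_smooth L0 L1 f.
Implicit Types x y h z : 'rV[R]_d.

Let L0_ge0 : 0 <= L0. Proof. by case: smooth_f. Qed.
Let L1_ge0 : 0 <= L1. Proof. by case: smooth_f. Qed.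
Let df x : differentiable f x. Proof. by case: smooth_f. Qed.

Local Notation bad e := (~ grad_bounded_near f e).

(** One h serves all z of the ball, so that the estimate survives at the limit of nested balls. *)
Definition steep (n : nat) (p : 'rV[R]_d * R) := exists2 h,
  `|h| <= n.+1%:R^-1 & forall z, `|z - p.1| <= p.2 ->
    n%:R * `|h| < `|f (z + h) - f z|.

(** The slope inequality of [bad_slope] is strict and f is continuous, so it persists on a small
    ball around the bad point with the same h. *)
Lemma bad_steep n (p : 'rV[R]_d * R) : bad p.1 -> 0 < p.2 ->
  exists p' : 'rV[R]_d * R, [/\ bad p'.1, 0 < p'.2,
    `|p'.1 - p.1| + p'.2 <= p.2 & steep n p'].
Proof.
move=> bp p0; pose r := Num.min (p.2 / 2) (n.+1%:R^-1).
have r0 : 0 < r by rewrite lt_min divr_gt0//= invr_gt0.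
have rp : r <= p.2 / 2 by rewrite ge_min lexx.
have rn : r <= n.+1%:R^-1 by rewrite ge_min lexx orbT.
have [e [h [be er hr slope]]] := bad_slope smooth_f bp r0 (ler0n R n).
have : \forall z \near e, n%:R * `|h| < `|f (z + h) - f z|.
  have cf y : {for y, continuous f} by exact: differentiable_continuous.
  have fh : (fun z => f (z + h)) @ e --> f (e + h).
    apply: (@cvg_comp _ _ _ (fun z => z + h) f _ _ _ _ (cf (e + h))).
    have addh : (fun z => z + h) @ e --> e + h.
      by apply: (@cvgD _ _ _ (nbhs e) _ id (fun=> h));
        [exact: cvg_id|exact: cvg_cst].
    exact: addh.
  exact: cvgr_norm_gt (cvgB fh (cf e)) _ slope.
move=> /nbhs_ballP[s /= s0 es].
exists (e, Num.min (s / 2) (p.2 / 2)); split => //=.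
- by rewrite lt_min !divr_gt0.
- have : Num.min (s / 2) (p.2 / 2) <= p.2 / 2 by rewrite ge_min lexx orbT.
  move=> /= H; apply: le_trans (lerD (le_trans (ltW er) rp) H) _; lra.
- exists h => [|z /= zs]; first exact: le_trans hr rn.
  apply: es; rewrite -ball_normE/= distrC; apply: le_lt_trans zs _.
  by apply: le_lt_trans (_ : s / 2 < s); [rewrite ge_min lexx|lra].
Qed.

(* A Baire argument on the set of points around which the gradient is
   unbounded: nested balls centred at such points, with difference quotients of
   f at smaller and smaller scales that tend to infinity, shrink to a point at
   which f would not be differentiable. *)
Lemma smooth_grad_bounded_near x : grad_bounded_near f x.
Proof.
apply: contrapT => bx.
pose good (p : 'rV[R]_d * R) := bad p.1 /\ 0 < p.2.
have [F FP] : exists F : nat * ('rV[R]_d * R) -> 'rV[R]_d * R, forall np,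
    good np.2 -> [/\ good (F np), `|(F np).1 - np.2.1| + (F np).2 <= np.2.2 &
      steep np.1 (F np)].
  suff /choice[F FP] : forall np, exists p', good np.2 -> [/\ good p',
      `|p'.1 - np.2.1| + p'.2 <= np.2.2 & steep np.1 p'] by exists F.
  move=> [n p] /=.
  have [[bp p0]|np] := pselect (good p); last by exists p.
  by have [p' [? ? ? ?]] := bad_steep n bp p0; exists p'.
pose u := fix u n := if n is m.+1 then F (m, u m) else (x, 1).
have ugood n : good (u n).
  by elim: n => [|n /(FP (n, u n))[]//]; split => //=; exact: ltr01.
pose B n : set 'rV[R]_d := [set z | `|z - (u n).1| <= (u n).2].
have BS n : B n.+1 `<=` B n.
  move=> z /= zn; have [_ /= Fn _] := FP (n, u n) (ugood n).
  apply: le_trans Fn; apply: le_trans (ler_distD (u n.+1).1 _ _) _.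
  by rewrite addrC lerD2l.
have BB n m : B (n + m)%N `<=` B n.
  by elim: m => [|m IH]; rewrite ?addn0// addnS; apply: subset_trans (BS _) IH.
have uB n : B n (u n).1 by rewrite /B/= subrr normr0; have [_ /ltW] := ugood n.
have Bclosed n : closed (B n).
  have [_ un0] := ugood n.
  rewrite [B n](_ : _ = closed_ball (u n).1 (u n).2);
    first exact: closed_ball_closed.
  by rewrite closed_ballE//; apply/seteqP; split => z;
    rewrite /B/closed_ball_/= distrC.
have B0 : compact (B 0%N).
  apply: bounded_closed_compact => //.
  exists (`|x| + 1); split; first exact: num_real.
  move=> M xM z /= zx; apply: ltW; apply: le_lt_trans xM.
  by rewrite -[z](subrK x) addrC; apply: le_trans (ler_normD _ _) _;
    rewrite lerD2l.
pose G : set_system 'rV[R]_d := (fun n => (u n).1) @ \oo.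
have GB n : G (B n).
  by exists n => // m /= nm; apply: (BB n (m - n)%N); rewrite subnKC.
(* The centres lie in the compact ball [B 0] and have a cluster point, which belongs to every [B n]
   because these are closed and nested. *)
have [z [_ zG]] := B0 G _ (GB 0%N).
have zB n : B n z by apply: Bclosed => V zV; exact: zG (GB n) zV.
have [K [s [K0 s0 fK]]] := differentiable_locally_lipschitz df z.
pose n := Num.truncn (Num.max K s^-1).
have nK : Num.max K s^-1 < n.+1%:R by exact: truncnS_gt.
(* [F (n.+1, u n.+1)] is [u n.+2]. Its h has norm at most 1 / (n + 2) < s, and its slope n + 1
   exceeds K. *)
have [_ _ [h hn fh]] := FP (n.+1, u n.+1) (ugood n.+1).
have := fh z (zB n.+2).
have hs : `|h| < s.
  apply: le_lt_trans hn _; rewrite invf_plt ?posrE//.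
  apply: le_lt_trans (_ : Num.max K s^-1 < _);
    first by rewrite le_max lexx orbT.
  by apply: lt_trans nK _; rewrite ltr_nat.
move=> /lt_le_trans/(_ (fK _ hs)); apply/negP; rewrite -leNgt.
apply: ler_wpM2r => //; apply: ltW; apply: le_lt_trans nK.
by rewrite le_max lexx.
Qed.

Lemma smooth_close x h : L1 * norm2 h <= 8^-1 ->
  norm2 (grad f (x + h) - grad f x) <=
    8 / 7 * (L0 + L1 * norm2 (grad f x)) * norm2 h.
Proof.
move=> hL.
have [M fM] := compact_grad_bounded (f := f) (@compact_segment _ _ x (x + h))
  (fun u _ => smooth_grad_bounded_near u).
exact: smooth_close_bounded fM hL.
Qed.

(** The gradient at a mean value point is compared with the one at x, which gives the quadratic term
    without the customary factor 1/2. *)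
Lemma smooth_descent x h : L1 * norm2 h <= 8^-1 ->
  f (x + h) <= f x + \sum_i grad f x 0 i * h 0 i
    + 8 / 7 * (L0 + L1 * norm2 (grad f x)) * norm2 h ^+ 2.
Proof.
move=> hL; have [t /andP[t0 t1] fE] := mvt_line df x h.
have th : norm2 (t *: h) <= norm2 h.
  by rewrite norm2Z ger0_norm// ler_piMl// norm2_ge0.
have K0 : 0 <= 8 / 7 * (L0 + L1 * norm2 (grad f x)).
  by rewrite mulr_ge0// addr_ge0// mulr_ge0// norm2_ge0.
have := smooth_close x (le_trans (ler_wpM2l L1_ge0 th) hL).
move=> /le_trans/(_ (ler_wpM2l K0 th))/(ler_wpM2r (norm2_ge0 h)).
rewrite -mulrA -expr2 => H.
rewrite -[f (x + h)](subrK (f x)) fE [leLHS]addrC -addrA lerD2l -lerBlDl.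
apply: le_trans H; apply: le_trans (cauchy_schwarz _ _).
rewrite -sumrB; apply: ler_sum => i _.
by rewrite coordB mulrBl.
Qed.

(** * Sign steps and their descent *)

Lemma sqrt_dim : Num.sqrt d%:R * Num.sqrt d%:R = d%:R :> R.
Proof. by rewrite -expr2 sqr_sqrtr. Qed.

Lemma norm2_sign (m : 'rV[R]_d) : norm2 (map_mx Num.sg m) <= Num.sqrt d%:R.
Proof.
apply: norm2_le; rewrite ?sqrtr_ge0// sqr_sqrtr//.
rewrite -[X in _ <= X%:R]card_ord -sumr_const; apply: ler_sum => i _.
by rewrite mxE; case: sgrP => _; rewrite ?expr0n ?sqrrN ?expr1n// ler01.
Qed.

Lemma sign_step_norm (gamma : R) (m : 'rV[R]_d) : 0 <= gamma ->
  norm2 (- (gamma *: map_mx Num.sg m)) <= gamma * Num.sqrt d%:R.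
Proof.
by move=> g0; rewrite norm2N norm2Z ger0_norm// ler_wpM2l// norm2_sign.
Qed.

Lemma sign_step_small (gamma : R) (m : 'rV[R]_d) : 0 <= gamma ->
  gamma * L1 * d%:R <= 8^-1 ->
  L1 * norm2 (- (gamma *: map_mx Num.sg m)) <= 8^-1.
Proof.
move=> g0 gL; apply: le_trans (ler_wpM2l L1_ge0 (sign_step_norm m g0)) _.
apply: le_trans gL; rewrite mulrCA mulrA; apply: ler_wpM2l;
  first by rewrite mulr_ge0.
rewrite -[leRHS]sqrt_dim; have [->|d0] := eqVneq d 0%N;
  first by rewrite mulr0n sqrtr0 mulr0.
apply: ler_peMr; first exact: sqrtr_ge0.
by rewrite -[leLHS]sqrtr1 ler_wsqrtr// ler1n lt0n.
Qed.

(** Coordinatewise, - a sg(b) <= - |a| + 2 |b - a|: if the signs of a and b disagree, then |a| <= |b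
    - a|. The factor d gamma^2 bounds the squared length of the step. *)
Lemma sign_descent (gamma : R) x (m : 'rV[R]_d) : 0 <= gamma ->
  gamma * L1 * d%:R <= 8^-1 ->
  f (x - gamma *: map_mx Num.sg m) <= f x - gamma * norm1 (grad f x)
    + 2 * gamma * norm1 (m - grad f x)
    + 8 / 7 * (L0 + L1 * norm1 (grad f x)) * (d%:R * gamma ^+ 2).
Proof.
move=> g0 gL; apply: le_trans (smooth_descent x (sign_step_small m g0 gL)) _.
apply: lerD; last first.
  apply: ler_pM.
  - by rewrite mulr_ge0// addr_ge0// mulr_ge0// norm2_ge0.
  - exact: sqr_ge0.
  - by apply: ler_wpM2l => //; rewrite lerD2l ler_wpM2l// norm2_le1.
  - rewrite -sqrt_dim -expr2 -exprMn ler_sqr ?nnegrE ?norm2_ge0//.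
      by rewrite mulrC; exact: sign_step_norm.
    by rewrite mulr_ge0// sqrtr_ge0.
rewrite -addrA lerD2l !norm1E !mulr_sumr -sumrN -big_split/=.
apply: ler_sum => i _; rewrite coordB coordN coordZ coord_sg.
move: (grad f x 0 i) (m 0 i) => a b.
have -> : a * - (gamma * Num.sg b) = gamma * - (a * Num.sg b) by ring.
have -> : - (gamma * `|a|) + 2 * gamma * `|b - a| =
  gamma * (- `|a| + 2 * `|b - a|) by ring.
apply: ler_wpM2l => //.
case: sgrP => [->|b0|b0]; rewrite ?mulr0 ?mulr1 ?mulrN1 ?oppr0 ?sub0r ?normrN.
- by rewrite addrC subr_ge0 ler_peMl// ler1n.
- have := ler_norm (b - a); have := normr_ge0 (b - a).
  case: (ler0P a) => a0; lra.
- have := ler_norm (a - b); have := normr_ge0 (a - b); rewrite (distrC a b).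
  case: (ler0P a) => a0; lra.
Qed.

(** The virtual step takes the exact gradient as momentum, so no error term remains. Its L1 term is
    at most 8/7 * 1/8 = 1/7 of the decrease, which leaves 6/7. The stepsize is free and is
    calibrated separately in each regime. *)
Lemma grad_norm1_le (gamma fstar : R) x : (forall y, fstar <= f y) -> 0 < gamma
  ->
  gamma * L1 * d%:R <= 8^-1 ->
  norm1 (grad f x) <= 7 / 6 * ((f x - fstar) / gamma + 8 / 7 * (L0 * (d%:R *
    gamma))).
Proof.
move=> fge g0 gL; have := sign_descent x (grad f x) (ltW g0) gL.
rewrite subrr => /(le_trans (fge _)).
have -> : norm1 (0 : 'rV[R]_d) = 0 by rewrite norm1E big1// => i _;
  rewrite mxE normr0.
have := ler_wpM2r (norm1_ge0 (grad f x)) gL.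
move: (norm1 _) => G GL; rewrite mulr0 addr0.
move=> H.
have : gamma * (6 / 7 * G) <= f x - fstar + 8 / 7 * L0 * (d%:R * gamma ^+ 2).
  by have := ler_wpM2l (ltW g0) GL; move: H; lra.
rewrite -ler_pdivlMl// => H1.
have -> : 7 / 6 * ((f x - fstar) * gamma^-1 + 8 / 7 * (L0 * (d%:R * gamma))) =
   7 / 6 * (gamma^-1 * (f x - fstar + 8 / 7 * L0 * (d%:R * gamma ^+ 2))).
  by field; rewrite gt_eqF.
by rewrite -ler_pdivrMl//; lra.
Qed.

End SmoothNoBadPoint.

(** * Pathwise descent *)

Section Recursion.
Context {R : realType}.

(* The first term of the bound is the contribution of the initial value e 0,
   the second one that of the increments s. *)
Lemma sum_linear_recursion (alpha b e0 : R) (e s : nat -> R) (n : nat) :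
  0 < alpha -> 0 <= b -> alpha + b = 1 -> (forall k, 0 <= s k) ->
  e 0%N <= b * e0 -> (forall k, e k.+1 <= b * (e k + s k)) ->
  \sum_(k < n) e k <=
    e0 * (\sum_(k < n) b ^+ k.+1) + alpha^-1 * \sum_(k < n) s k.
Proof.
move=> a0 b0 ab s0 e00 eS.
pose r := fix r k := if k is j.+1 then b * (r j + s j) else 0.
have r_ge0 k : 0 <= r k by elim: k => //= k IH; rewrite mulr_ge0// addr_ge0.
have er k : e k <= e0 * b ^+ k.+1 + r k.
  elim: k => [|k IH]; first by rewrite expr1 mulrC addr0.
  apply: le_trans (eS k) _; rewrite /= [b ^+ _]exprS mulrCA -mulrDr ler_wpM2l//.
  by rewrite addrA lerD2r.
(* Adding the current value [r m] makes the bound inductive, since alpha + b = 1; that term is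
   dropped at the end. *)
have sr m : alpha * (\sum_(k < m) r k) + r m <= \sum_(k < m) s k.
  elim: m => [|m IH]; first by rewrite !big_ord0 mulr0 addr0.
  rewrite !big_ord_recr/=; have : b * s m <= s m by rewrite ler_piMl//; lra.
  have -> : alpha * (\sum_(i < m) r i + r m) + b * (r m + s m) =
    alpha * (\sum_(i < m) r i) + (alpha + b) * r m + b * s m by ring.
  by rewrite ab mul1r => bs; exact: lerD.
apply: (@le_trans _ _ (\sum_(k < n) (e0 * b ^+ k.+1 + r k))).
  by apply: ler_sum => k _; exact: er.
rewrite big_split/= -mulr_sumr lerD2l ler_pdivlMl//.
by apply: le_trans (sr n); rewrite lerDl.
Qed.

(** Both bounds are used on the same sum: the first against the part of the initial gradient of
    order eps, the second against its part of order eps [lam]. *)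
Lemma sum_geometric_le (alpha b : R) (n : nat) : 0 < alpha -> 0 <= b ->
  alpha + b = 1 ->
  \sum_(k < n) b ^+ k.+1 <= n%:R /\ \sum_(k < n) b ^+ k.+1 <= alpha^-1.
Proof.
move=> a0 b0 ab; have b1 : b <= 1 by lra.
split.
  rewrite -[X in _ <= X%:R]card_ord -sumr_const.
  by apply: ler_sum => k _; exact: exprn_ile1.
rewrite -[leRHS]mulr1 ler_pdivlMl//.
have /(congr1 -%R) := subrX1 b n.
have -> : - ((b - 1) * \sum_(i < n) b ^+ i) = alpha * \sum_(i < n) b ^+ i.
  have -> : alpha = 1 - b by lra.
  by ring.
rewrite opprB => bn; apply: le_trans (_ : alpha * \sum_(i < n) b ^+ i <= _).
  apply: ler_wpM2l; first exact: ltW.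
  by apply: ler_sum => k _; rewrite exprS ler_piMl// exprn_ge0.
by rewrite -bn gerBl exprn_ge0.
Qed.

End Recursion.

(* The part of the momentum that is due to the centered estimates. *)
Fixpoint noise_average {R : realType} {d : nat} {Xi : Type}
    (f : 'rV[R]_d -> R) (g : 'rV[R]_d -> Xi -> 'rV[R]_d) (x1 : 'rV[R]_d)
    (b gamma : R) (xi : nat -> Xi) (k : nat) : 'rV[R]_d :=
  if k is k'.+1 then
    let x := (msignsgd_state g x1 (fun=> b) (fun=> gamma) xi k').1 in
    b *: noise_average f g x1 b gamma xi k' + (1 - b) *: (g x (xi k) - grad f x)
  else 0.

Section Pathwise.
Context {R : realType} {d : nat} {Xi : Type}.
Variables (f : 'rV[R]_d -> R) (fstar L0 L1 : R) (g : 'rV[R]_d -> Xi ->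
  'rV[R]_d).
Variables (x1 : 'rV[R]_d) (b gamma : R) (xi : nat -> Xi).
Hypothesis smooth_f : L0L1_smooth L0 L1 f.
Hypothesis f_ge : forall x, fstar <= f x.
Hypotheses (b_ge0 : 0 <= b) (gamma_gt0 : 0 < gamma).

Local Notation state := (msignsgd_state g x1 (fun=> b) (fun=> gamma) xi).
Local Notation X k := (state k).1.
Local Notation M k := (state k).2.
Local Notation N := (noise_average f g x1 b gamma xi).

Lemma stateS_momentum k : M k.+1 = b *: M k + (1 - b) *: g (X k) (xi k.+1).
Proof. by rewrite /=; case: (state k). Qed.

Lemma stateS_iterate k : X k.+1 = X k - gamma *: map_mx Num.sg (M k.+1).
Proof. by rewrite /=; case: (state k). Qed.

(** Since m^0 = 0, the first momentum lacks a share b of the gradient; this is the source of the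
    discounted initial gradient. *)
Lemma momentum_drift0 : M 1%N - N 1%N - grad f x1 = - b *: grad f x1.
Proof.
rewrite stateS_momentum /= !scaler0 !add0r.
move: (g _ _) (grad f x1) => u v.
apply/rowP => i; rewrite !(coordD, coordN, coordZ); ring.
Qed.

Lemma momentum_driftS k :
  M k.+2 - N k.+2 - grad f (X k.+1) =
  b *: (M k.+1 - N k.+1 - grad f (X k) + (grad f (X k) - grad f (X k.+1))).
Proof.
rewrite stateS_momentum.
have -> : N k.+2 = b *: N k.+1 + (1 - b) *: (g (X k.+1) (xi k.+2) - grad f (X
  k.+1)) by [].
rewrite [M k.+1 - _ - _ + _]addrA subrK.
move: (M k.+1) (N k.+1) (X k.+1) (g _ _) => m n x u; move: (grad f x) => v.
apply/rowP => i; rewrite !(coordD, coordN, coordZ); ring.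
Qed.

(** Put c = gamma d / (1 - b), and let U be the sum of L0 + L1 |grad f x^k|_1. The drift contributes
    16/7 c U and the descent remainder at most 8/7 c U. The stepsize condition says c L1 <= 1/8, so
    the L1 part of 24/7 c U is at most 3/7 of the sum of gradient norms; absorbing it leaves 4/7. *)
Lemma pathwise_bound (T : nat) : gamma * d%:R * L1 <= (1 - b) / 8 -> b < 1 ->
  4 / 7 * \sum_(k < T) norm1 (grad f (X k)) <=
    (f x1 - fstar) / gamma
    + 2 * norm1 (grad f x1) * \sum_(k < T) b ^+ k.+1
    + 24 / 7 * (gamma * d%:R / (1 - b) * L0) * T%:R
    + 2 * \sum_(k < T) norm1 (N k.+1).
Proof.
move=> gL b1; have [L0_ge0 L1_ge0 _ _] := smooth_f.
have gL8 : gamma * L1 * d%:R <= 8^-1 by rewrite mulrAC; move: b_ge0; lra.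
pose a k := norm1 (grad f (X k)).
pose e k := norm1 (M k.+1 - N k.+1 - grad f (X k)).
pose s k := norm1 (grad f (X k) - grad f (X k.+1)).
have a_ge0 k : 0 <= a k by exact: norm1_ge0.
(* One factor sqrt d comes from the passage to the l1 norm, the other from the length of the sign
   step. *)
have s_le k : s k <= 8 / 7 * (gamma * d%:R) * (L0 + L1 * a k).
  rewrite /s -[grad f (X k) - _]opprB; apply: le_trans (norm1_le2 _) _.
  rewrite norm2N stateS_iterate.
  apply: le_trans (ler_wpM2l (sqrtr_ge0 _)
    (smooth_close smooth_f (X k)
      (sign_step_small smooth_f (M k.+1) (ltW gamma_gt0) gL8))) _.
  have aL : 0 <= 8 / 7 * (L0 + L1 * norm2 (grad f (X k))).
    by rewrite mulr_ge0// addr_ge0// mulr_ge0// norm2_ge0.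
  apply: le_trans (ler_wpM2l (sqrtr_ge0 _) (ler_wpM2l aL
    (sign_step_norm _ (ltW gamma_gt0)))) _.
  set q := Num.sqrt _.
  have -> : q * (8 / 7 * (L0 + L1 * norm2 (grad f (X k))) * (gamma * q)) =
    8 / 7 * (gamma * (q * q)) * (L0 + L1 * norm2 (grad f (X k))) by ring.
  rewrite sqrt_dim; apply: ler_wpM2l; first by rewrite !mulr_ge0// ltW.
  by rewrite lerD2l ler_wpM2l// norm2_le1.
have sumT : \sum_(k < T) (L0 + L1 * a k) = T%:R * L0 + L1 * \sum_(k < T) a k.
  by rewrite big_split/= sumr_const card_ord -mulr_sumr mulr_natl.
have alpha0 : 0 < 1 - b by lra.
have sumE : \sum_(k < T) e k <= a 0%N * (\sum_(k < T) b ^+ k.+1)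
    + (1 - b)^-1 * (8 / 7 * (gamma * d%:R) * (T%:R * L0 + L1 * \sum_(k < T) a
      k)).
  apply: le_trans (sum_linear_recursion (alpha := 1 - b) (s := s) (e0 := a 0%N)
    _ alpha0 b_ge0 _ _ _ _) _.
  - by rewrite subrK.
  - by move=> k; exact: norm1_ge0.
  - by rewrite /e momentum_drift0 norm1Z normrN ger0_norm.
  - move=> k; have -> : e k.+1 = norm1 (b *: (M k.+1 - N k.+1 - grad f (X k)
        + (grad f (X k) - grad f (X k.+1)))).
      rewrite -[LHS]/(norm1 (M k.+2 - N k.+2 - grad f (X k.+1))).
      by congr norm1; exact: momentum_driftS.
    rewrite (norm1Z b) (ger0_norm b_ge0).
    by apply: ler_wpM2l b_ge0 _ _ _; exact: norm1D.
  rewrite lerD2l ler_wpM2l// ?invr_ge0 ?(ltW alpha0)// -sumT mulr_sumr.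
  by apply: ler_sum => k _.
have step k : gamma * a k <= f (X k) - f (X k.+1) + 2 * gamma * (e k + norm1 (N
  k.+1))
    + 8 / 7 * (L0 + L1 * a k) * (d%:R * gamma ^+ 2).
  have := sign_descent smooth_f (X k) (M k.+1) (ltW gamma_gt0) gL8.
  rewrite -stateS_iterate -/(a k).
  have : 2 * gamma * norm1 (M k.+1 - grad f (X k)) <= 2 * gamma * (e k + norm1
    (N k.+1)).
    apply: ler_wpM2l; first by rewrite mulr_ge0// ltW.
    have -> : M k.+1 - grad f (X k) = M k.+1 - N k.+1 - grad f (X k) + N k.+1.
      by rewrite addrAC subrK.
    exact: norm1D.
  move: (f (X k.+1)) (2 * gamma * _) (2 * gamma * _) (8 / 7 * _ * _).
  by move=> u v w z; lra.
have := ler_sum (index_enum 'I_T) (fun (k : 'I_T) (_ : true) => step k).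
rewrite -mulr_sumr !big_split/= -mulr_sumr big_split/= -mulr_suml -mulr_sumr
  sumT.
have -> : \sum_(k < T) (f (X k)) + \sum_(k < T) (- f (X k.+1)) = f x1 - f (X T).
  elim: T {sumT sumE} => [|n IH]; first by rewrite !big_ord0 addr0 subrr.
  by rewrite !big_ord_recr/= addrACA IH addrA subrK.
have := f_ge (X T).
move: sumE; rewrite -/(a 0%N).
have : 0 <= \sum_(k < T) a k by apply: sumr_ge0.
move: (\sum_(k < T) norm1 (N k.+1)) (\sum_(k < T) e k) (\sum_(k < T) b ^+ k.+1)
  => n E B.
move: (\sum_(k < T) a k) (a 0%N) (f (X T)) (f x1) => A a0 fT f1 A0 EB fTge H.
pose c := gamma * d%:R / (1 - b).
pose U := T%:R * L0 + L1 * A.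
have U0 : 0 <= U by rewrite addr_ge0// mulr_ge0.
have gc : gamma * d%:R <= c.
  rewrite ler_pdivlMr// ler_piMr ?mulr_ge0 ?(ltW gamma_gt0)//.
  by move: b_ge0; lra.
have cL : c * L1 <= 8^-1 by rewrite /c mulrAC ler_pdivrMr//; lra.
have cLA := ler_wpM2r A0 cL.
have gcU := ler_wpM2r U0 gc.
have {}EB : E <= a0 * B + 8 / 7 * (c * U).
  apply: le_trans EB _; rewrite lerD2l /c -/U le_eqVlt; apply/orP; left.
  by apply/eqP; ring.
rewrite -(ler_pM2l gamma_gt0).
have gEB := ler_wpM2l (ltW gamma_gt0) EB.
have ggcU := ler_wpM2l (ltW gamma_gt0) gcU.
have gcLA := ler_wpM2l (ltW gamma_gt0) cLA.
have -> : gamma * ((f1 - fstar) / gamma + 2 * a0 * B + 24 / 7 * (c * L0) * T%:R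
  + 2 * n)
  = f1 - fstar + gamma * (2 * a0 * B + 24 / 7 * (c * L0) * T%:R + 2 * n).
  by field; rewrite gt_eqF.
move: H gEB ggcU gcLA fTge; rewrite -/U.
have -> : 8 / 7 * U * (d%:R * gamma ^+ 2) = 8 / 7 * (gamma * (gamma * d%:R *
  U)) by ring.
have -> : gamma * (c * U) = gamma * (c * L0 * T%:R) + gamma * (c * L1 * A).
  by rewrite /U; ring.
have -> : gamma * (a0 * B + 8 / 7 * (c * U)) = gamma * (a0 * B)
  + 8 / 7 * (gamma * (c * L0 * T%:R)) + 8 / 7 * (gamma * (c * L1 * A)).
  by rewrite /U; ring.
have -> : gamma * (2 * a0 * B + 24 / 7 * (c * L0) * T%:R + 2 * n) =
  2 * (gamma * (a0 * B)) + 24 / 7 * (gamma * (c * L0 * T%:R)) + 2 * (gamma * n).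
  by ring.
have -> : gamma * (4 / 7 * A) = 4 / 7 * (gamma * A) by ring.
have -> : gamma * (8^-1 * A) = 8^-1 * (gamma * A) by ring.
have -> : 2 * gamma * (E + n) = 2 * (gamma * E) + 2 * (gamma * n) by ring.
move: (gamma * A) (gamma * E) (gamma * (a0 * B)) (gamma * (c * L0 * T%:R))
  (gamma * (c * L1 * A)) (gamma * n) (gamma * (gamma * d%:R * U)) => *; lra.
Qed.

End Pathwise.

(** * Independence of the past *)

Section Freezing.
Local Open Scope ereal_scope.
Context {dO dY dX : measure_display} {Om : measurableType dO}
  {Yt : measurableType dY} {Xi : measurableType dX} {R : realType}.
Variables (P : probability Om R) (D : probability Xi R).

(** Independence on rectangles identifies the law of the pair with the product of the law of [Y] and
    [D]; Tonelli then integrates over [zeta] with [Y] frozen. *)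
Lemma freezing (Y : {mfun Om >-> Yt}) (zeta : Om -> Xi)
    (Phi : Yt * Xi -> \bar R) :
  measurable_fun setT zeta ->
  (forall A C, measurable A -> measurable C ->
    P (Y @^-1` A `&` zeta @^-1` C) = P (Y @^-1` A) * D C) ->
  measurable_fun setT Phi -> (forall p, 0 <= Phi p) ->
  \int[P]_w Phi (Y w, zeta w) = \int[P]_w \int[D]_z Phi (Y w, z).
Proof.
move=> mzeta indep mPhi Phi0.
have mpair : measurable_fun setT (fun w => (Y w, zeta w)).
  exact: measurable_fun_pair.
pose pairm : {mfun Om >-> (Yt * Xi)%type} :=
  HB.pack (fun w => (Y w, zeta w)) (isMeasurableFun.Build _ _ _ _ _ mpair).
have -> : \int[P]_w Phi (Y w, zeta w) = \int[distribution P pairm]_p Phi p.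
  by rewrite ge0_integral_distribution.
have -> : \int[distribution P pairm]_p Phi p =
    \int[(distribution P Y) \x D]_p Phi p.
  apply: eq_measure_integral => A mA _; apply/esym.
  apply: (product_measure_unique _ mA) => B C mB mC.
  by rewrite -[LHS]/(P (Y @^-1` B `&` zeta @^-1` C)) indep.
rewrite fubini_tonelli1// /fubini_F ge0_integral_distribution//.
  exact: measurable_fun_fubini_tonelli_F.
by move=> w; exact: integral_ge0.
Qed.

End Freezing.

Section IndependentSigma.
Local Open Scope ereal_scope.
Context {dO dX : measure_display} {Om : measurableType dO}
  {Xi : measurableType dX} {R : realType}.
Variables (P : probability Om R) (D : probability Xi R) (zeta : Om -> Xi).
Hypothesis mzeta : measurable_fun setT zeta.
Variable G : set (set Om).
Hypotheses (Gm : G `<=` measurable) (GT : G setT) (GI : setI_closed G).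
Hypothesis indep : forall A C, G A -> measurable C ->
  P (A `&` zeta @^-1` C) = P A * D C.

(** For fixed [C] both sides are finite measures in [A] that agree on the pi-system [G]. *)
Lemma independent_g_sigma A C : <<s G >> A -> measurable C ->
  P (A `&` zeta @^-1` C) = P A * D C.
Proof.
move=> GA mC.
have mE : measurable (zeta @^-1` C) by rewrite -[_ @^-1` _]setTI; exact: mzeta.
have DC0 : (0 <= fine (D C))%R by exact: fine_ge0.
pose r : {nonneg R} := NngNum DC0.
have rE : (r%:num)%:E = D C by rewrite /= fineK// fin_num_measure.
suff : mrestr P mE A = mscale r P A.
  by rewrite /mscale rE muleC.
apply: (@g_sigma_algebra_measure_unique _ R Om G Gm (fun=> setT) (fun=> GT) _
  (mrestr P mE) (mscale r P) GI _ _ A GA).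
- by rewrite bigcup_const//; exists 0%N.
- by move=> B GB; rewrite -[RHS]/((r%:num)%:E * P B) rE muleC -indep.
- move=> _; apply: le_lt_trans (ltry 1).
  by rewrite -[leLHS]/(P (setT `&` _)) setTI probability_le1.
Qed.

(** The sample point itself, seen through the coarser sigma-algebra: used as [Y] in [freezing], it
    carries the whole past at once. *)
Definition id_g_sigma : Om -> g_sigma_algebraType G := id.

Lemma measurable_id_g_sigma : measurable_fun setT id_g_sigma.
Proof.
move=> _ A GA; rewrite setTI; move: A GA.
exact: smallest_sub (@sigma_algebra_measurable _ Om) Gm.
Qed.

Lemma freezing_g_sigma (Phi : g_sigma_algebraType G * Xi -> \bar R) :
  measurable_fun setT (Phi : (g_sigma_algebraType G : measurableType _) * Xi ->
    _) ->
  (forall p, 0 <= Phi p) ->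
  \int[P]_w Phi (w, zeta w) = \int[P]_w \int[D]_z Phi (w, z).
Proof.
move=> mPhi Phi0.
pose idm : {mfun Om >-> g_sigma_algebraType G} :=
  HB.pack id_g_sigma (isMeasurableFun.Build _ _ _ _ _ measurable_id_g_sigma).
apply: (@freezing _ _ _ Om (g_sigma_algebraType G) Xi R P D idm zeta Phi) => //.
by move=> A C GA mC; exact: independent_g_sigma.
Qed.

End IndependentSigma.

(** * Finitely valued variables and measurability of the iterates *)

Section FinitelyValued.
Context {dO : measure_display} {Om : measurableType dO}.

Definition finitely_valued {V : choiceType} (X : Om -> V) :=
  (exists s : seq V, forall w, X w \in s) /\
  forall v, measurable [set w | X w = v].

Lemma finitely_valued_cst {V : choiceType} (v : V) :
  finitely_valued (fun=> v).
Proof.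
split; first by exists [:: v] => w; rewrite inE.
move=> u; have [->|vu] := eqVneq v u.
  by rewrite [X in measurable X](_ : _ = setT)//; apply/seteqP; split.
rewrite [X in measurable X](_ : _ = set0)//; apply/seteqP;
  split => // w /= /eqP.
by rewrite (negbTE vu).
Qed.

Lemma finitely_valued_comp {V W : choiceType} (F : V -> W) (X : Om -> V) :
  finitely_valued X -> finitely_valued (F \o X).
Proof.
move=> [[s Xs] mX]; split; first by exists (map F s) => w; exact: map_f.
move=> u; rewrite [X in measurable X](_ : _ =
    \bigcup_(v in [set` [seq v <- s | F v == u]]) [set w | X w = v]).
  by apply: fin_bigcup_measurable => // v _; exact: mX.
apply/seteqP; split => w /=; first by move=> <-; exists (X w) => //=;
  rewrite mem_filter eqxx Xs.
by move=> [v /=]; rewrite mem_filter => /andP[/eqP <- _] ->.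
Qed.

Lemma finitely_valued_pair {V W : choiceType} (X : Om -> V) (Y : Om -> W) :
  finitely_valued X -> finitely_valued Y -> finitely_valued (fun w => (X w, Y
    w)).
Proof.
move=> [[s Xs] mX] [[t Yt] mY]; split.
  by exists [seq (x, y) | x <- s, y <- t] => w; exact: allpairs_f.
move=> [u v]; rewrite [X in measurable X](_ : _ =
    [set w | X w = u] `&` [set w | Y w = v]); first exact: measurableI.
by apply/seteqP; split => w /= [-> ->].
Qed.

(** Cutting the preimage along the finitely many values of [X] takes the place of joint
    measurability of [h]. *)
Lemma measurable_select {V : choiceType} {dW : measure_display}
    {W : measurableType dW} (X : Om -> V) (h : V -> Om -> W) :
  finitely_valued X -> (forall v, measurable_fun setT (h v)) ->
  measurable_fun setT (fun w => h (X w) w).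
Proof.
move=> [[s Xs] mX] mh _ B mB; rewrite setTI.
rewrite [X in measurable X](_ : _ = \bigcup_(v in [set` s])
    ([set w | X w = v] `&` (h v @^-1` B))).
  apply: fin_bigcup_measurable => // v _; apply: measurableI => //.
  by rewrite -[_ @^-1` _]setTI; exact: mh.
apply/seteqP; split => w /=; first by exists (X w) => //; exact: Xs.
by move=> [v _ [/= ->]].
Qed.

(** A code for the sign vector in a finite type, whose enumeration lists all possible values. *)
Definition sign_pattern {R : realType} {d : nat} (m : 'rV[R]_d) :
    {ffun 'I_d -> bool * bool} :=
  [ffun i => (0 < m 0 i, m 0 i < 0)].

Lemma sg_sign_pattern {R : realType} {d : nat} (m : 'rV[R]_d) :
  map_mx Num.sg m =
  \row_i ((sign_pattern m i).1%:R - (sign_pattern m i).2%:R).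
Proof.
apply/rowP => i; rewrite !mxE ffunE/=.
by case: sgrP => x0; rewrite ?(ltxx, x0, ltW, subr0, sub0r)// ltNge ltW//=
  ?subr0 ?sub0r.
Qed.

Lemma finitely_valued_sign_pattern {R : realType} {d : nat} (M : Om ->
  'rV[R]_d) :
  (forall i, measurable_fun setT (fun w => M w 0 i)) ->
  finitely_valued (fun w => sign_pattern (M w)).
Proof.
move=> mM; split; first by exists (enum {: {ffun 'I_d -> bool * bool}}) => w;
  rewrite mem_enum.
move=> p; rewrite [X in measurable X](_ : _ = \bigcap_(i in [set: 'I_d])
    ([set w | (0 < M w 0 i) = (p i).1] `&` [set w | (M w 0 i < 0) = (p i).2])).
  apply: fin_bigcap_measurable => // i _; apply: measurableI.
    have := @measurable_fun_ltr _ Om R setT (cst 0) (fun w => M w 0 i) _ (mM i).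
    move=> /(_ (measurable_cst _) measurableT [set (p i).1]).
    by rewrite setTI; apply.
  have := @measurable_fun_ltr _ Om R setT (fun w => M w 0 i) (cst 0) (mM i).
  move=> /(_ (measurable_cst _) measurableT [set (p i).2]).
  by rewrite setTI; apply.
apply/seteqP; split => w /=; first by move=> <- i _ /=; rewrite ffunE.
by move=> H; apply/ffunP => i; rewrite ffunE; have [/= -> ->] := H i I;
  case: (p i).
Qed.

End FinitelyValued.

Section MeasurableState.
Context {dO dX : measure_display} {Om : measurableType dO}
  {Xi : measurableType dX} {R : realType} {d : nat}.
Variables (f : 'rV[R]_d -> R) (g : 'rV[R]_d -> Xi -> 'rV[R]_d).
Hypothesis mg : forall x i, measurable_fun setT (fun z => g x z 0 i).
Variables (x1 : 'rV[R]_d) (b gamma : R) (xi : nat -> Om -> Xi).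

Local Notation state k w :=
  (msignsgd_state g x1 (fun=> b) (fun=> gamma) (fun j => xi j w) k).
Local Notation N k w := (noise_average f g x1 b gamma (fun j => xi j w) k).

(** The measurable structure on [Om] is arbitrary, because the lemma is used both for the original
    sigma-algebra and for that of the past. *)
Lemma measurable_state k :
  (forall j, (1 <= j <= k)%N -> measurable_fun setT (xi j)) ->
  [/\ finitely_valued (fun w => (state k w).1),
    forall i, measurable_fun setT (fun w => (state k w).2 0 i) &
    forall i, measurable_fun setT (fun w => N k w 0 i)].
Proof.
elim: k => [_|k IH mxi].
  split => [|i|i]; [exact: finitely_valued_cst|exact: measurable_cst|].
  exact: measurable_cst.
have [|fX mM mN] := IH.
  by move=> j /andP[j1 jk]; apply: mxi; rewrite j1 leqW.
have mxik : measurable_fun setT (xi k.+1) by apply: mxi; rewrite /= leqnn.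
have mgX i : measurable_fun setT (fun w => g (state k w).1 (xi k.+1 w) 0 i).
  apply: (measurable_select (h := fun x w => g x (xi k.+1 w) 0 i) fX) => x.
  exact: measurableT_comp (mg x i) mxik.
have mMS i : measurable_fun setT (fun w => (state k.+1 w).2 0 i).
  under eq_fun do rewrite stateS_momentum coordD !coordZ.
  by apply: measurable_funD; apply: measurable_funM.
split => // [|i].
  rewrite (_ : (fun w => (state k.+1 w).1) =
    (fun q : 'rV[R]_d * {ffun 'I_d -> bool * bool} => q.1 - gamma *: \row_i
      ((q.2 i).1%:R - (q.2 i).2%:R)) \o
    (fun w => ((state k w).1, sign_pattern (state k.+1 w).2))); last first.
    by apply/funext => w; rewrite stateS_iterate sg_sign_pattern.
  apply: finitely_valued_comp; apply: finitely_valued_pair => //.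
  exact: finitely_valued_sign_pattern.
rewrite (_ : (fun w => _) = (fun w => b * N k w 0 i + (1 - b) *
    (g (state k w).1 (xi k.+1 w) 0 i - grad f (state k w).1 0 i))); last first.
  by apply/funext => w; rewrite /= coordD !coordZ coordB.
have mgrad : measurable_fun setT (fun w => grad f (state k w).1 0 i).
  by apply: (measurable_select (h := fun x _ => grad f x 0 i) fX) => x;
    exact: measurable_cst.
apply: measurable_funD; apply: measurable_funM => //.
exact: measurable_funB.
Qed.

End MeasurableState.

(** * The sigma-algebra of the past samples *)

Section Past.
Local Open Scope ereal_scope.
Context {dO dX : measure_display} {Om : measurableType dO}
  {Xi : measurableType dX} {R : realType}.
Variables (P : probability Om R) (D : probability Xi R) (T : nat)
  (xi : nat -> Om -> Xi).
Hypothesis iid : iid_samples P D T xi.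

(** Rectangles only: they form a pi-system, and the product formula of [iid_samples] applies to them
    directly. *)
Definition past (k : nat) : set (set Om) :=
  [set B | exists2 A : nat -> set Xi, (forall j, measurable (A j)) &
    B = \bigcap_(j in [set` iota 1 k]) (xi j @^-1` A j)].

Lemma past_setT k : past k setT.
Proof.
by exists (fun=> setT) => //; apply/seteqP; split => // w _ j _.
Qed.

Lemma past_setI k : setI_closed (past k).
Proof.
move=> _ _ [A mA ->] [B mB ->]; exists (fun j => A j `&` B j).
  by move=> j; exact: measurableI.
by rewrite -bigcapI.
Qed.

Lemma past_sample k j : (1 <= j <= k)%N ->
  measurable_fun setT (xi j : g_sigma_algebraType (past k) -> Xi).
Proof.
move=> jk _ A mA; rewrite setTI; apply: sub_sigma_algebra.
exists (fun i => if i == j then A else setT); first by move=> i; case: ifP.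
apply/seteqP; split => [w /= Aw i _ /=|w /=]; first by case: eqP => // ->.
by move=> /(_ j) /=; rewrite eqxx; apply; rewrite mem_iota add1n ltnS.
Qed.

Lemma past_measurable k : (k <= T)%N -> past k `<=` measurable.
Proof.
move=> kT _ [A mA ->]; apply: fin_bigcap_measurable => //= j.
rewrite mem_iota add1n ltnS => /andP[j1 jk].
case: iid => /(_ j); rewrite j1 (leq_trans jk kT) => /(_ isT)[mxi _] _.
by rewrite -[_ @^-1` _]setTI; exact: mxi.
Qed.

Lemma past_independent k A C : (k < T)%N -> past k A -> measurable C ->
  P (A `&` xi k.+1 @^-1` C) = P A * D C.
Proof.
move=> kT [B mB ->] mC; case: iid => law prodP.
have iota_T n : (n <= T)%N -> forall j, j \in iota 1 n -> (1 <= j <= T)%N.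
  by move=> nT j; rewrite mem_iota add1n ltnS => /andP[-> /leq_trans ->].
have iotaE : iota 1 k.+1 = rcons (iota 1 k) k.+1.
  by rewrite -(addn1 k) iotaD cats1 add1n addn1.
(* With [C] as its side of index [k.+1], the intersection is again a rectangle, over one more
   sample. *)
pose B' j := if j == k.+1 then C else B j.
have B'E j : j \in iota 1 k -> B' j = B j.
  by rewrite mem_iota add1n /B' => /andP[_]; case: ltngtP.
have -> : \bigcap_(j in [set` iota 1 k]) xi j @^-1` B j `&` xi k.+1 @^-1` C =
    \bigcap_(j in [set` iota 1 k.+1]) xi j @^-1` B' j.
  rewrite iotaE; apply/seteqP; split => w /=.
    move=> [wB wC] j /=; rewrite mem_rcons inE => /predU1P[->|jk].
      by rewrite /= /B' eqxx.
    by rewrite /= B'E//; exact: wB.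
  move=> wB; split => [j /= jk|]; first by rewrite -B'E//; apply: wB;
    rewrite /= mem_rcons inE jk orbT.
  by have := wB k.+1; rewrite /= /B' eqxx; apply; rewrite mem_rcons inE eqxx.
rewrite prodP//; last 3 first.
- exact: iota_uniq.
- exact: iota_T.
- by move=> j; rewrite /B'; case: ifP.
rewrite prodP//; last 2 first.
- exact: iota_uniq.
- by apply: iota_T; exact: ltnW.
rewrite iotaE big_rcons/=.
rewrite /B' eqxx; congr (_ * _).
  by apply: eq_big_seq => j /B'E; rewrite /B' => ->.
by have [] := law k.+1 kT => _ ->.
Qed.

Lemma freezing_past k (Phi : g_sigma_algebraType (past k) * Xi -> \bar R) :
  (k < T)%N ->
  measurable_fun setT (Phi : (g_sigma_algebraType (past k) : measurableType _)
    * Xi -> _) ->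
  (forall p, 0 <= Phi p) ->
  \int[P]_w Phi (w, xi k.+1 w) = \int[P]_w \int[D]_z Phi (w, z).
Proof.
move=> kT; apply: freezing_g_sigma.
- by case: iid => /(_ k.+1 kT)[].
- exact: past_measurable (ltnW kT).
- exact: past_setT.
- exact: past_setI.
- by move=> A C; exact: past_independent.
Qed.

End Past.

(** * Heavy-tailed noise *)

Section PseudoHuber.
Context {R : realType} (tau : R).
Hypothesis tau_gt0 : 0 < tau.

Definition pseudo_huber (x : R) : R := Num.sqrt (tau ^+ 2 + x ^+ 2).

Let arg_ge0 (x : R) : 0 <= tau ^+ 2 + x ^+ 2.
Proof. by rewrite addr_ge0 ?sqr_ge0. Qed.

Lemma pseudo_huber_sqr x : pseudo_huber x ^+ 2 = tau ^+ 2 + x ^+ 2.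
Proof. exact: sqr_sqrtr. Qed.

Lemma pseudo_huber_ge0 x : 0 <= pseudo_huber x. Proof. exact: sqrtr_ge0. Qed.

Lemma pseudo_huber_ge_tau x : tau <= pseudo_huber x.
Proof.
rewrite -ler_sqr ?nnegrE ?pseudo_huber_ge0 ?(ltW tau_gt0)//.
by rewrite pseudo_huber_sqr lerDl sqr_ge0.
Qed.

Lemma pseudo_huber_ge_norm x : `|x| <= pseudo_huber x.
Proof.
rewrite -ler_sqr ?nnegrE ?pseudo_huber_ge0//.
by rewrite pseudo_huber_sqr real_normK ?num_real// lerDr sqr_ge0.
Qed.

Lemma pseudo_huber0 : pseudo_huber 0 = tau.
Proof. by rewrite /pseudo_huber expr0n addr0 sqrtr_sqr gtr0_norm. Qed.

Lemma pseudo_huber_le x (y : R) : 0 <= y -> tau ^+ 2 + x ^+ 2 <= y ^+ 2 ->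
  pseudo_huber x <= y.
Proof. by move=> y0; rewrite -pseudo_huber_sqr ler_sqr ?nnegrE
  ?pseudo_huber_ge0. Qed.

Lemma measurable_pseudo_huber : measurable_fun setT pseudo_huber.
Proof.
apply: continuous_measurable_fun => x; apply: continuous_comp;
  last exact: sqrt_continuous.
apply: cvgD; first exact: cvg_cst.
exact: exprn_continuous.
Qed.

(** This is convexity between x and 0, where the value is tau. The squares of the two sides differ
    by 2 b (1 - b) tau (h - tau) >= 0. *)
Lemma pseudo_huber_contract (b x : R) : 0 <= b <= 1 ->
  pseudo_huber (b * x) <= b * pseudo_huber x + (1 - b) * tau.
Proof.
move=> /andP[b0 b1]; have h0 := pseudo_huber_ge0 x.
have hsq := pseudo_huber_sqr x; have ht := pseudo_huber_ge_tau x.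
have b10 : 0 <= 1 - b by lra.
apply: pseudo_huber_le; first by rewrite addr_ge0// mulr_ge0// ltW.
rewrite sqrrD !exprMn hsq -subr_ge0.
move: (pseudo_huber x) ht => h ht {hsq h0}.
have -> : b ^+ 2 * (tau ^+ 2 + x ^+ 2) + b * h * ((1 - b) * tau) *+ 2
    + (1 - b) ^+ 2 * tau ^+ 2 - (tau ^+ 2 + b ^+ 2 * x ^+ 2) =
  2 * (b * (1 - b)) * tau * (h - tau) by ring.
by rewrite mulr_ge0 ?subr_ge0// mulr_ge0 ?(ltW tau_gt0)// !mulr_ge0.
Qed.

(** The tangent bound sqrt(h^2 + t) <= h + t / (2 h) with t = 2 x y + y^2, followed by h >= tau. *)
Lemma pseudo_huber_taylor (x y : R) :
  pseudo_huber (x + y) <=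
    pseudo_huber x + x / pseudo_huber x * y + y ^+ 2 / (2 * tau).
Proof.
have ht := pseudo_huber_ge_tau x; have hsq := pseudo_huber_sqr x.
move: (pseudo_huber x) ht hsq => h ht hsq.
have h0 : 0 < h by apply: lt_le_trans ht.
apply: (@le_trans _ _ (h + x / h * y + y ^+ 2 / (2 * h))); last first.
  by rewrite lerD2l ler_wpM2l ?sqr_ge0// lef_pV2 ?posrE ?mulr_gt0// ler_pM2l.
have E : h + x / h * y + y ^+ 2 / (2 * h) = h + (2 * x * y + y ^+ 2) / (2 * h).
  by field; rewrite gt_eqF.
rewrite E; apply: pseudo_huber_le.
  have -> : h + (2 * x * y + y ^+ 2) / (2 * h) =
    (2 * h ^+ 2 + 2 * x * y + y ^+ 2) / (2 * h) by field; rewrite gt_eqF.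
  apply: divr_ge0; last by rewrite mulr_ge0// ltW.
  rewrite hsq; have := sqr_ge0 (x + y); have := sqr_ge0 x; have := sqr_ge0 tau.
  by move=> t1 t2; rewrite sqrrD; lra.
have -> : (h + (2 * x * y + y ^+ 2) / (2 * h)) ^+ 2 =
    h ^+ 2 + 2 * x * y + y ^+ 2 + ((2 * x * y + y ^+ 2) / (2 * h)) ^+ 2.
  by field; rewrite gt_eqF.
rewrite hsq; have := sqr_ge0 ((2 * x * y + y ^+ 2) / (2 * h)).
by move: (((2 * x * y + y ^+ 2) / (2 * h)) ^+ 2) => q q0; rewrite sqrrD; lra.
Qed.

(** The function and its linear part each vary by at most |y|, whence the factor 2. *)
Lemma pseudo_huber_lipschitz (x y : R) :
  pseudo_huber (x + y) <= pseudo_huber x + x / pseudo_huber x * y + 2 * `|y|.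
Proof.
have ht := pseudo_huber_ge_tau x; have hsq := pseudo_huber_sqr x.
have hn := pseudo_huber_ge_norm x.
move: (pseudo_huber x) ht hsq hn => h ht hsq hn.
have h0 : 0 < h by apply: lt_le_trans ht.
have xy : `|x / h * y| <= `|y|.
  by rewrite normrM ler_piMl// normrM normfV (gtr0_norm h0) ler_pdivrMr// mul1r.
apply: (@le_trans _ _ (h + `|y|)); last first.
  by move: xy; rewrite ler_norml => /andP[+ _]; lra.
apply: pseudo_huber_le; first by rewrite addr_ge0// ltW.
rewrite sqrrD sqrrD hsq real_normK ?num_real//.
have : x * y <= h * `|y|.
  apply: le_trans (ler_norm _) _; rewrite normrM.
  exact: ler_wpM2r.
by rewrite !mulr2n; move: (x * y) (h * `|y|) => u v H; lra.
Qed.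

(** With u = |y| / tau, the quadratic bound serves for u <= 1, where u^2 <= u^kappa as kappa <= 2,
    and the Lipschitz bound for u > 1, where u <= u^kappa as kappa > 1. *)
Lemma pseudo_huber_power (kappa x y : R) : 1 < kappa <= 2 ->
  pseudo_huber (x + y) <= pseudo_huber x + x / pseudo_huber x * y
    + 2 * tau * (`|y| / tau) `^ kappa.
Proof.
move=> /andP[k1 k2]; have [->|y0] := eqVneq y 0.
  rewrite !addr0 mulr0 addr0 lerDl mulr_ge0 ?powR_ge0// mulr_ge0// ltW//.
have u0 : 0 < `|y| / tau by rewrite divr_gt0// normr_gt0.
have yE : `|y| = tau * (`|y| / tau) by field; rewrite gt_eqF.
have [u1|u1] := leP (`|y| / tau) 1.
  apply: le_trans (pseudo_huber_taylor x y) _; rewrite lerD2l.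
  have : (`|y| / tau) ^+ 2 <= (`|y| / tau) `^ kappa.
    rewrite -powR_mulrn ?(ltW u0)//; apply: ger_powR; last exact: k2.
    by rewrite u0 u1.
  have -> : y ^+ 2 / (2 * tau) = 2^-1 * tau * (`|y| / tau) ^+ 2.
    rewrite -[y ^+ 2](real_normK (num_real y)).
    by field; rewrite gt_eqF.
  move=> H; have p0 := powR_ge0 (`|y| / tau) kappa.
  apply: le_trans (ler_wpM2l _ H) _; first by rewrite mulr_ge0 ?(ltW tau_gt0)//
    invr_ge0.
  apply: ler_wpM2r => //; rewrite ler_wpM2r ?(ltW tau_gt0)//; lra.
apply: le_trans (pseudo_huber_lipschitz x y) _;
  rewrite lerD2l -mulrA ler_wpM2l//.
rewrite {1}yE; apply: ler_wpM2l; first exact: ltW.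
rewrite -[leLHS]powRr1 ?(ltW u0)//; apply: ler_powR; exact: ltW.
Qed.

End PseudoHuber.

(** * Expected size of the noise average *)

Section ExpectedPseudoHuber.
Local Open Scope ereal_scope.
Context {dX : measure_display} {Xi : measurableType dX} {R : realType}.
Variables (D : probability Xi R) (theta : Xi -> R) (tau kappa s : R).
Hypotheses (tau_gt0 : (0 < tau)%R) (kappa_bounds : (1 < kappa <= 2)%R).
Hypothesis itheta : D.-integrable setT (EFin \o theta).
Hypothesis mean_theta : \int[D]_z (theta z)%:E = 0.
Hypothesis moment_theta : \int[D]_z (`|theta z| `^ kappa)%:E <= (s `^ kappa)%:E.

Lemma expected_pseudo_huber (n a : R) : (0 <= a)%R ->
  \int[D]_z (pseudo_huber tau (n + a * theta z))%:E <=
    (pseudo_huber tau n + 2 * tau * (a / tau) `^ kappa * s `^ kappa)%:E.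
Proof.
move=> a0; have mtheta : measurable_fun setT theta.
  by apply/measurable_EFinP; exact: measurable_int itheta.
set c := (n / pseudo_huber tau n * a)%R.
set K := (2 * tau * (a / tau) `^ kappa)%R.
have K0 : (0 <= K)%R by rewrite mulr_ge0 ?powR_ge0// mulr_ge0// ltW.
have mpow : measurable_fun setT (fun z => `|theta z| `^ kappa)%R.
  apply: (measurableT_comp (measurable_powR kappa)).
  exact: measurableT_comp.
have H z : (pseudo_huber tau (n + a * theta z) <=
    pseudo_huber tau n + c * theta z + K * `|theta z| `^ kappa)%R.
  apply: le_trans (pseudo_huber_power tau_gt0 n (a * theta z) kappa_bounds) _.
  rewrite normrM (ger0_norm a0) (mulrAC a) powRM ?divr_ge0 ?(ltW tau_gt0)//.
  by rewrite /c /K !mulrA.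
have ipow : D.-integrable setT (fun z => (`|theta z| `^ kappa)%:E).
  apply/integrableP; split; first exact/measurable_EFinP.
  under eq_integral do rewrite gee0_abs ?lee_fin ?powR_ge0//.
  exact: le_lt_trans moment_theta (ltry _).
apply: (@le_trans _ _ (\int[D]_z
    ((pseudo_huber tau n)%:E + (c * theta z)%:E + (K * `|theta z| `^
      kappa)%:E))).
  apply: ge0_le_integral => //.
  - by move=> z _; rewrite lee_fin pseudo_huber_ge0.
  - apply/measurable_EFinP; apply: (measurableT_comp (measurable_pseudo_huber
    tau)).
    by apply: measurable_funD => //; exact: measurable_funM.
  - by apply/measurable_EFinP; apply: measurable_funD;
    [apply: measurable_funD => //|];
      exact: measurable_funM.
  - by move=> z _; rewrite lee_fin.
have ic : D.-integrable setT (fun z => (c * theta z)%:E).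
  by under eq_fun do rewrite EFinM; exact: integrableZl.
have iK : D.-integrable setT (fun z => (K * `|theta z| `^ kappa)%:E).
  by under eq_fun do rewrite EFinM; exact: integrableZl.
have ih : D.-integrable setT (fun z : Xi => (pseudo_huber tau n)%:E).
  exact: finite_measure_integrable_cst.
rewrite integralD//; last exact: integrableD.
rewrite integralD//.
under [X in _ + X + _]eq_integral do rewrite EFinM.
under [X in _ + X <= _]eq_integral do rewrite EFinM.
rewrite (integralZl _ itheta)// (integralZl _ ipow)// mean_theta mule0 adde0.
rewrite integral_cst//= probability_setT mule1 EFinD leeD2l// (EFinM K).
by apply: lee_wpmul2l => //; rewrite lee_fin.
Qed.

End ExpectedPseudoHuber.

Section ExpectedNoise.
Local Open Scope ereal_scope.
Context {R : realType} {d : nat}.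
Context {dX : measure_display} {Xi : measurableType dX}.
Context {dO : measure_display} {Om : measurableType dO}.
Variables (f : 'rV[R]_d -> R) (D : probability Xi R)
  (g : 'rV[R]_d -> Xi -> 'rV[R]_d) (kappa : R) (sigma : 'rV[R]_d)
  (P : probability Om R) (xi : nat -> Om -> Xi) (T : nat)
  (x1 : 'rV[R]_d) (b gamma tau : R).
Hypothesis kappa_bounds : (1 < kappa <= 2)%R.
Hypothesis noisy : heavy_tailed_estimates D f g kappa sigma.
Hypothesis iid : iid_samples P D T xi.
Hypotheses (b_ge0 : (0 <= b)%R) (b_lt1 : (b < 1)%R) (tau_gt0 : (0 < tau)%R).

Local Notation state k w :=
  (msignsgd_state g x1 (fun=> b) (fun=> gamma) (fun j => xi j w) k).
Local Notation N k w := (noise_average f g x1 b gamma (fun j => xi j w) k).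

Let mg x i : measurable_fun setT (fun z => g x z 0%R i).
Proof. by have [/measurable_int/measurable_EFinP] := noisy x i. Qed.

Lemma measurable_state_iid k : (k <= T)%N ->
  [/\ finitely_valued (fun w => (state k w).1),
    forall i, measurable_fun setT (fun w => (state k w).2 0%R i) &
    forall i, measurable_fun setT (fun w => N k w 0%R i)].
Proof.
move=> kT; apply: measurable_state => // j /andP[j1 jk].
by case: iid => /(_ j); rewrite j1 (leq_trans jk kT) => /(_ isT)[].
Qed.

Let centered_estimate x i (theta := fun z => (g x z 0%R i - grad f x 0%R i)%R) :
  [/\ D.-integrable setT (EFin \o theta), \int[D]_z (theta z)%:E = 0 &
    \int[D]_z (`|theta z| `^ kappa)%:E <= (sigma 0%R i `^ kappa)%:E].
Proof.
have [ig eg mom] := noisy x i.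
have ic : D.-integrable setT (fun=> (grad f x 0%R i)%:E).
  exact: finite_measure_integrable_cst.
split.
- rewrite [X in _.-integrable _ X](_ : _ = (fun z => (g x z 0%R i)%:E - (grad f
  x 0%R i)%:E)).
    exact: integrableB.
  by apply/funext => z; rewrite /= EFinB.
- under eq_integral do rewrite EFinB.
  rewrite integralB// integral_cst//= probability_setT mule1.
  by move: eg; rewrite unlock => ->; rewrite subee.
- by move: mom; rewrite unlock.
Qed.

Lemma expected_noise_step k i : (k < T)%N ->
  \int[P]_w (pseudo_huber tau (N k.+1 w 0%R i))%:E <=
    b%:E * \int[P]_w (pseudo_huber tau (N k w 0%R i))%:E
    + ((1 - b) * tau + 2 * tau * ((1 - b) / tau) `^ kappa * sigma 0%R i `^
      kappa)%:E.
Proof.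
move=> kT.
have b1 : (0 <= 1 - b)%R by rewrite subr_ge0 ltW.
pose C := (2 * tau * ((1 - b) / tau) `^ kappa * sigma 0 i `^ kappa)%R.
have C0 : (0 <= C)%R.
  by rewrite !mulr_ge0 ?powR_ge0// ltW.
pose Past : measurableType _ := g_sigma_algebraType (past xi k).
(* The new sample becomes a free variable; everything else depends on the past alone. *)
pose Phi (p : Past * Xi) := (pseudo_huber tau (b * N k p.1 0 i
  + (1 - b) * (g (state k p.1).1 p.2 0 i - grad f (state k p.1).1 0 i)))%:E.
have [fX _ mN] := @measurable_state _ _ Past Xi R d f g mg x1 b gamma xi k
  (fun j jk => past_sample jk).
have mfst : measurable_fun setT (fst : Past * Xi -> Past) by exact:
  measurable_fst.
have fXp : finitely_valued (fun p : Past * Xi => (state k p.1).1).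
  case: fX => -[s Xs] mX; split; first by exists s => p; exact: Xs.
  by move=> v; have := mfst measurableT _ (mX v); rewrite setTI.
have mPhi : measurable_fun setT Phi.
  apply/measurable_EFinP; apply: (measurableT_comp (measurable_pseudo_huber
    tau)).
  apply: (measurable_select (h := fun x (p : Past * Xi) =>
    b * N k p.1 0 i + (1 - b) * (g x p.2 0 i - grad f x 0 i))%R fXp) => x.
  apply: measurable_funD; apply: measurable_funM => //.
    exact: measurableT_comp (mN i) mfst.
  apply: measurable_funB => //.
  exact: measurableT_comp (mg x i) measurable_snd.
have -> : \int[P]_w (pseudo_huber tau (N k.+1 w 0%R i))%:E =
    \int[P]_w Phi (w, xi k.+1 w).
  apply: eq_integral => w _; rewrite /Phi /=; congr (pseudo_huber _ _)%:E.
  by rewrite coordD !coordZ coordB.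
rewrite (freezing_past iid kT)//; last by move=> p;
  rewrite lee_fin pseudo_huber_ge0.
have [_ _ mNk] := measurable_state_iid (ltnW kT).
have mH : measurable_fun setT (fun w => pseudo_huber tau (N k w 0%R i)).
  exact: measurableT_comp (measurable_pseudo_huber tau) (mNk i).
have mHE : measurable_fun setT (fun w => (pseudo_huber tau (N k w 0%R i))%:E).
  exact/measurable_EFinP.
(* For frozen w, [expected_pseudo_huber] is applied with n = b N^k and a = 1 - b; the contraction
   then turns h(b N^k) into b h(N^k) + (1 - b) tau. *)
apply: (@le_trans _ _ (\int[P]_w (b%:E * (pseudo_huber tau (N k w 0%R i))%:E
    + ((1 - b) * tau + C)%:E))); last first.
  rewrite ge0_integralD//; last first.
  - by move=> w _; rewrite lee_fin addr_ge0// mulr_ge0// ltW.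
  - exact: measurable_funeM.
  - by move=> w _; rewrite mule_ge0// lee_fin// pseudo_huber_ge0.
  rewrite ge0_integralZl//; last by move=> w _;
    rewrite lee_fin pseudo_huber_ge0.
  by rewrite integral_cst//= probability_setT mule1.
have mF : measurable_fun setT (fubini_F D Phi : Past -> \bar R).
  apply: measurable_fun_fubini_tonelli_F => // p.
  by rewrite lee_fin pseudo_huber_ge0.
apply: ge0_le_integral => //.
- by move=> w _; apply: integral_ge0 => z _; rewrite lee_fin pseudo_huber_ge0.
- exact: (measurableT_comp mF (measurable_id_g_sigma (past_measurable iid (ltnW
  kT)))).
- apply: emeasurable_funD; last exact: measurable_cst.
  exact: measurable_funeM.
move=> w _; have [it mt momt] := centered_estimate (state k w).1 i.
have EH := expected_pseudo_huber tau_gt0 kappa_bounds it mt momt (b * N k w 0%R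
  i)%R b1.
apply: (le_trans EH).
rewrite -/C -EFinM -EFinD lee_fin addrA lerD2r.
by apply: pseudo_huber_contract => //; rewrite b_ge0 ltW.
Qed.

(** The bound is the fixed point of y = b y + (1 - b) tau + C, and the initial value h(0) = tau lies
    below it. *)
Lemma expected_noise k i : (k <= T)%N ->
  \int[P]_w (pseudo_huber tau (N k w 0%R i))%:E <=
    (tau + 2 * tau * ((1 - b) / tau) `^ kappa * sigma 0 i `^ kappa / (1 -
      b))%:E.
Proof.
have b1 : (0 < 1 - b)%R by rewrite subr_gt0.
set C := (2 * tau * ((1 - b) / tau) `^ kappa * sigma 0 i `^ kappa)%R.
have C0 : (0 <= C)%R.
  by rewrite !mulr_ge0 ?powR_ge0// ltW.
elim: k => [_|k IH kT].
  under eq_integral do rewrite mxE pseudo_huber0//.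
  rewrite integral_cst//= probability_setT mule1 lee_fin lerDl divr_ge0//.
  exact: ltW.
apply: le_trans (expected_noise_step i kT) _.
apply: le_trans (leeD2r _ (lee_wpmul2l _ (IH (ltnW kT)))) _;
  first by rewrite lee_fin.
rewrite -EFinM -EFinD lee_fin -/C.
have -> : (b * (tau + C / (1 - b)) + ((1 - b) * tau + C) = tau + C / (1 - b))%R.
  by field; rewrite gt_eqF.
by [].
Qed.

Lemma expected_noise_norm1 k : (0 < k <= T)%N ->
  \int[P]_w (norm1 (N k w))%:E <=
    (d%:R * tau + 2 * tau * ((1 - b) / tau) `^ kappa / (1 - b)
      * \sum_i sigma 0 i `^ kappa)%:E.
Proof.
move=> /andP[_ kT]; have [_ _ mN] := measurable_state_iid kT.
have mEN i : measurable_fun setT (fun w => (`|N k w 0%R i|%R)%:E).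
  by apply/measurable_EFinP; exact: measurableT_comp.
under eq_integral do rewrite norm1E -sumEFin.
rewrite ge0_integral_sum//.
have -> : (d%:R * tau + 2 * tau * ((1 - b) / tau) `^ kappa / (1 - b)
      * \sum_i sigma 0 i `^ kappa = \sum_(i < d) (tau + 2 * tau *
      ((1 - b) / tau) `^ kappa * sigma 0 i `^ kappa / (1 - b)))%R.
  rewrite big_split/= sumr_const card_ord mulr_natl mulr_sumr; congr (_ + _)%R.
  by apply: eq_bigr => i _; rewrite mulrAC.
rewrite -sumEFin; apply: lee_sum => i _.
apply: le_trans (expected_noise i kT); apply: ge0_le_integral => //.
- by apply/measurable_EFinP; exact: measurableT_comp (measurable_pseudo_huber
  tau) (mN i).
- by move=> w _; rewrite lee_fin pseudo_huber_ge_norm.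
Qed.

End ExpectedNoise.

(** * Parameter tuning *)

Section CappedRatio.
Context {R : realType}.
Variables (kappa c a s : R).
Hypotheses (kappa_bounds : 1 < kappa <= 2) (c_ge1 : 1 <= c).
Hypotheses (a_ge0 : 0 <= a) (s_ge0 : 0 <= s).
Hypothesis small_a : c ^+ 2 * a * (1 + (c ^+ 2 * s) `^ (kappa / (kappa - 1)))
  <= 1.

Let k1 : 1 < kappa. Proof. by case/andP: kappa_bounds. Qed.
Let c_gt0 : 0 < c. Proof. exact: lt_le_trans c_ge1. Qed.
Let c2_gt0 : 0 < c ^+ 2. Proof. exact: exprn_gt0. Qed.
Let lnc_ge0 : 0 <= ln c. Proof. exact: ln_ge0. Qed.

Lemma small_a_le : a <= (c ^+ 2)^-1.
Proof.
rewrite -[leRHS]mulr1 ler_pdivlMl//; apply: le_trans small_a.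
by apply: ler_peMr; [rewrite mulr_ge0// ltW|rewrite lerDl powR_ge0].
Qed.

(** In multiplicative form, (c^2 a)^(kappa - 1) (c^2 s)^kappa <= 1. Logarithms make all powers of a,
    s and c linear. *)
Lemma ln_small_a : 0 < a -> 0 < s ->
  (kappa - 1) * (2 * ln c + ln a) + kappa * (2 * ln c + ln s) <= 0.
Proof.
move=> a0 s0.
have : c ^+ 2 * a * (c ^+ 2 * s) `^ (kappa / (kappa - 1)) <= 1.
  apply: le_trans small_a; apply: ler_wpM2l;
    first by rewrite mulr_ge0 ?(ltW c2_gt0).
  by rewrite lerDr.
have cs0 : 0 < c ^+ 2 * s by rewrite mulr_gt0.
have ca0 : 0 < c ^+ 2 * a by rewrite mulr_gt0.
have : ln (c ^+ 2) = 2 * ln c by rewrite lnXn// mulr_natl.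
move: (c ^+ 2) cs0 ca0 c2_gt0 => C2 cs0 ca0 C20 lnC2.
rewrite -ler_ln ?posrE ?mulr_gt0 ?powR_gt0// ln1.
rewrite lnM ?posrE ?powR_gt0// ln_powR !lnM ?posrE// lnC2.
have k10 : 0 < kappa - 1 by rewrite subr_gt0.
move=> H; have := ler_wpM2l (ltW k10) H; rewrite mulr0.
have -> : (kappa - 1) * (2 * ln c + ln a + kappa / (kappa - 1) * (2 * ln c + ln
  s))
  = (kappa - 1) * (2 * ln c + ln a) + kappa * (2 * ln c + ln s).
  by field; rewrite gt_eqF.
by [].
Qed.

(** In the application a = lam / T and alpha = 1 - beta: the first conclusion bounds lam / (T
    alpha), the second is the noise condition of [noise_level_le] with rho = 1 / c. *)
Lemma power_bounds_of_ln (alpha : R) : 0 < alpha -> 0 < a -> 0 < s ->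
  ln a - ln alpha <= - (2 * ln c) ->
  kappa * (ln alpha + ln s) <= ln alpha - kappa * ln c ->
  a / alpha <= (c ^+ 2)^-1 /\ (alpha * s) `^ kappa <= alpha * (c^-1) `^ kappa.
Proof.
move=> al0 a0 s0 H1 H2; split.
  rewrite -ler_ln ?posrE ?divr_gt0 ?invr_gt0// ln_div ?posrE// lnV ?posrE//.
  by rewrite lnXn// -[ln c *+ 2]mulr_natl.
rewrite -ler_ln ?posrE ?mulr_gt0 ?powR_gt0 ?mulr_gt0 ?invr_gt0//.
rewrite ln_powR !lnM ?posrE ?powR_gt0 ?invr_gt0// ln_powR lnV ?posrE//.
by rewrite mulrN.
Qed.

Lemma power_bounds_capped : s <= c^-1 ->
  a / 1 <= (c ^+ 2)^-1 /\ (1 * s) `^ kappa <= 1 * (c^-1) `^ kappa.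
Proof.
move=> sc; rewrite divr1 !mul1r small_a_le; split => //.
by apply: ge0_ler_powR; rewrite ?nnegrE ?invr_ge0 ?(ltW c_gt0)// ltW//
  (lt_trans _ k1).
Qed.

Lemma a_le_invc : a <= c^-1.
Proof.
apply: le_trans small_a_le _; rewrite lef_pV2 ?posrE//.
by rewrite expr2 ler_peMl// ltW.
Qed.

(** Below the cap, the exponent is such that (alpha s)^kappa = alpha (a / alpha)^kappa, so the
    second bound follows from the first; the first is [ln_small_a] divided by 2 kappa - 1. *)
Lemma capped_ratio_large_bounds (x y : R) (alpha := capped_ratio x y (kappa /
  (2 * kappa - 1))) :
  (y == 0) = (s == 0) -> x / y = a / s -> 0 < alpha ->
  a / alpha <= (c ^+ 2)^-1 /\ (alpha * s) `^ kappa <= alpha * (c^-1) `^ kappa.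
Proof.
rewrite /alpha /capped_ratio => -> ->; case: eqVneq => [s0|sn0] al0.
  by apply: power_bounds_capped; rewrite s0 invr_ge0 ltW.
have s0 : 0 < s by rewrite lt_neqAle eq_sym sn0.
set r := kappa / (2 * kappa - 1) in al0 *.
have k210 : 0 < 2 * kappa - 1 by move: k1; lra.
have r0 : 0 < r by rewrite divr_gt0//; move: k1; lra.
(* Where the cap is active, s <= a <= 1 / c, and alpha = 1 satisfies both bounds. *)
have [H|H] := leP 1 ((a / s) `^ r).
  apply: power_bounds_capped; apply: le_trans a_le_invc.
  rewrite leNgt; apply/negP => las.
  have : (a / s) `^ r < 1 `^ r.
    by apply: gt0_ltr_powR; rewrite ?nnegrE ?divr_ge0// ltr_pdivrMr// mul1r.
  by rewrite powR1 ltNge H.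
have {}al0 : 0 < (a / s) `^ r by move: al0; rewrite min_r// ltW.
have a0 : 0 < a.
  rewrite lt_neqAle a_ge0 andbT eq_sym; apply: contraTneq al0 => ->.
  by rewrite mul0r powR0 ?ltxx// gt_eqF.
have lnal : ln ((a / s) `^ r) = r * (ln a - ln s).
  by rewrite ln_powR ln_div ?posrE.
have key := ln_small_a a0 s0.
have H1 : ln a - r * (ln a - ln s) <= - (2 * ln c).
  rewrite -(ler_pM2l k210); move: key.
  have -> : (2 * kappa - 1) * (ln a - r * (ln a - ln s)) =
    (2 * kappa - 1) * ln a - kappa * (ln a - ln s) by rewrite /r; field;
      rewrite gt_eqF.
  by move: (ln a) (ln s) (ln c) => A S l; lra.
apply: power_bounds_of_ln => //; rewrite lnal//.
have -> : kappa * (r * (ln a - ln s) + ln s) =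
  r * (ln a - ln s) + kappa * (ln a - r * (ln a - ln s)).
  by rewrite /r; field; rewrite gt_eqF.
rewrite lerD2l -[leRHS]mulrN; apply: ler_wpM2l; first by move: k1; lra.
by apply: le_trans H1 _; move: lnc_ge0; lra.
Qed.

(** Here (alpha s)^kappa = alpha (a / alpha)^(kappa / 2) below the cap, so that a / alpha <= c^-2
    yields exactly the factor c^-kappa. *)
Lemma capped_ratio_small_bounds (x y : R) (alpha := capped_ratio x y (kappa /
  (3 * kappa - 2))) :
  (y == 0) = (s == 0) -> x / y = a / s ^+ 2 -> 0 < alpha ->
  a / alpha <= (c ^+ 2)^-1 /\ (alpha * s) `^ kappa <= alpha * (c^-1) `^ kappa.
Proof.
rewrite /alpha /capped_ratio => -> ->; case: eqVneq => [s0|sn0] al0.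
  by apply: power_bounds_capped; rewrite s0 invr_ge0 ltW.
have s0 : 0 < s by rewrite lt_neqAle eq_sym sn0.
have s20 : 0 < s ^+ 2 by rewrite exprn_gt0.
set r := kappa / (3 * kappa - 2) in al0 *.
have k320 : 0 < 3 * kappa - 2 by move: k1; lra.
have r0 : 0 < r by rewrite divr_gt0//; move: k1; lra.
have [H|H] := leP 1 ((a / s ^+ 2) `^ r).
  apply: power_bounds_capped.
  have : s ^+ 2 <= c^-1 ^+ 2.
    rewrite exprVn; apply: le_trans small_a_le; rewrite leNgt;
      apply/negP => las.
    have : (a / s ^+ 2) `^ r < 1 `^ r.
      by apply: gt0_ltr_powR; rewrite ?nnegrE ?divr_ge0 ?(ltW s20)//
        ltr_pdivrMr// mul1r.
    by rewrite powR1 ltNge H.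
  by rewrite ler_sqr// nnegrE invr_ge0 ltW.
have {}al0 : 0 < (a / s ^+ 2) `^ r by move: al0; rewrite min_r// ltW.
have a0 : 0 < a.
  rewrite lt_neqAle a_ge0 andbT eq_sym; apply: contraTneq al0 => ->.
  by rewrite mul0r powR0 ?ltxx// gt_eqF.
have lnal : ln ((a / s ^+ 2) `^ r) = r * (ln a - 2 * ln s).
  by rewrite ln_powR ln_div ?posrE// lnXn// mulr_natl.
have key := ln_small_a a0 s0.
have H1 : ln a - r * (ln a - 2 * ln s) <= - (2 * ln c).
  rewrite -(ler_pM2l k320); move: key.
  have -> : (3 * kappa - 2) * (ln a - r * (ln a - 2 * ln s)) =
    (3 * kappa - 2) * ln a - kappa * (ln a - 2 * ln s) by rewrite /r; field;
      rewrite gt_eqF.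
  have : 0 <= (kappa - 1) * ln c by rewrite mulr_ge0// subr_ge0 ltW.
  by move: lnc_ge0; move: (ln a) (ln s) (ln c) => A S l; lra.
apply: power_bounds_of_ln => //; rewrite lnal//.
have -> : kappa * (r * (ln a - 2 * ln s) + ln s) =
  r * (ln a - 2 * ln s) + kappa * ((ln a - r * (ln a - 2 * ln s)) / 2).
  by rewrite /r; field; rewrite gt_eqF.
rewrite lerD2l -[leRHS]mulrN; apply: ler_wpM2l; first by move: k1; lra.
by lra.
Qed.

End CappedRatio.

Lemma capped_ratio_le1 {R : realType} (x y p : R) : capped_ratio x y p <= 1.
Proof. by rewrite /capped_ratio; case: ifP => // _; rewrite ge_min lexx. Qed.

Lemma capped_ratio_ge0 {R : realType} (x y p : R) : 0 <= capped_ratio x y p.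
Proof. by rewrite /capped_ratio; case: ifP => // _;
  rewrite le_min ler01 powR_ge0. Qed.

Lemma capped_ratio_gt0 {R : realType} (x y p : R) : 0 < x -> 0 <= y ->
  0 < capped_ratio x y p.
Proof.
move=> x0 y0; rewrite /capped_ratio; case: eqVneq => // yn0.
by rewrite lt_min ltr01 powR_gt0// divr_gt0// lt_neqAle eq_sym yn0.
Qed.

Section NoiseLevel.
Context {R : realType} {d : nat}.
Variables (sigma : 'rV[R]_d) (kappa eps eta rho alpha : R).
Hypotheses (d_gt0 : (0 < d)%N) (kappa_bounds : 1 < kappa <= 2).
Hypotheses (sigma_ge0 : forall i, 0 <= sigma 0 i).
Hypotheses (eps_gt0 : 0 < eps) (eta_gt0 : 0 < eta) (alpha_gt0 : 0 < alpha).
Hypotheses (rho_ge0 : 0 <= rho) (rho_eta : rho <= eta / 2).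
Hypothesis noise_small :
  (alpha * (Num.sqrt d%:R * lp_norm kappa sigma / eps)) `^ kappa <= alpha * rho
    `^ kappa.

Lemma lp_norm_powR : lp_norm kappa sigma `^ kappa = \sum_i sigma 0 i `^ kappa.
Proof.
have k0 : 0 < kappa by case/andP: kappa_bounds => k1 _; exact: lt_trans k1.
rewrite /lp_norm -powRrM mulVf ?gt_eqF// powRr1; last first.
  by apply: sumr_ge0 => i _; exact: powR_ge0.
by apply: eq_bigr => i _; rewrite ger0_norm.
Qed.

(** This [tau] gives d tau = eta eps, and the moment term is no larger: with q = sqrt d, q^kappa <=
    d since kappa <= 2, and (rho / eta)^kappa <= 1/2 since kappa > 1. *)
Lemma noise_level_le (tau := eta * eps / d%:R) :
  d%:R * tau + 2 * tau * (alpha / tau) `^ kappa / alpha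
      * \sum_i sigma 0 i `^ kappa <= 2 * (eta * eps).
Proof.
have /andP[k1 k2] := kappa_bounds.
have D0 : 0 < d%:R :> R by rewrite ltr0n.
have tau0 : 0 < tau by rewrite divr_gt0// mulr_gt0.
have dtau : d%:R * tau = eta * eps by rewrite /tau mulrCA mulfV ?mulr1// gt_eqF.
pose q : R := Num.sqrt d%:R.
have q1 : 1 <= q by rewrite -sqrtr1 ler_wsqrtr// ler1n.
have q0 : 0 < q by apply: lt_le_trans q1.
have qq : q ^+ 2 = d%:R by rewrite sqr_sqrtr.
have S0 : 0 <= lp_norm kappa sigma by exact: powR_ge0.
have small := noise_small.
set S := lp_norm kappa sigma in S0 small *.
rewrite -lp_norm_powR -/S dtau.
have -> : 2 * tau * (alpha / tau) `^ kappa / alpha * S `^ kappa =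
  2 * tau / alpha * ((alpha / tau) `^ kappa * S `^ kappa) by ring.
have at0 : 0 <= alpha / tau by rewrite divr_ge0// ltW.
rewrite -powRM//.
have -> : alpha / tau * S = alpha * (q * S / eps) * (q / eta).
  rewrite /tau -qq; field.
  by rewrite !gt_eqF.
have qe0 : 0 <= q / eta by rewrite divr_ge0// ltW.
rewrite powRM//; last first.
  by rewrite mulr_ge0 ?(ltW alpha_gt0)// divr_ge0 ?(ltW eps_gt0)// mulr_ge0//
    ltW.
have H1 : (q / eta) `^ kappa * rho `^ kappa <= d%:R / 2.
  rewrite -powRM//.
  have -> : q / eta * rho = q * (rho / eta) by ring.
  have re0 : 0 <= rho / eta by rewrite divr_ge0// ltW.
  have re1 : rho / eta <= 2^-1 by rewrite ler_pdivrMr// mulrC.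
  rewrite powRM ?(ltW q0)//; apply: ler_pM; rewrite ?powR_ge0//.
    by rewrite -qq -(powR_mulrn 2 (ltW q0)); exact: ler_powR.
  apply: (le_trans _ re1); have [->|re] := eqVneq (rho / eta) 0.
    by rewrite powR0// gt_eqF// (lt_trans _ k1).
  rewrite -[leRHS]powRr1//; apply: ger_powR; last exact: ltW.
  by rewrite lt_neqAle eq_sym re re0/=; apply: (le_trans re1); lra.
have H2 : (alpha * (q * S / eps)) `^ kappa * (q / eta) `^ kappa <= alpha *
  (d%:R / 2).
  apply: le_trans (ler_wpM2r (powR_ge0 _ _) small) _.
  rewrite -mulrA; apply: ler_wpM2l; first exact: ltW.
  by rewrite mulrC.
have ta0 : 0 <= 2 * tau / alpha by rewrite divr_ge0 ?(ltW alpha_gt0)//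
  mulr_ge0// ltW.
have := ler_wpM2l ta0 H2.
have -> : 2 * tau / alpha * (alpha * (d%:R / 2)) = d%:R * tau.
  by field; rewrite gt_eqF.
by rewrite dtau; lra.
Qed.

End NoiseLevel.

(** * From the pathwise bound to the mean gradient norm *)

Section MeanGradient.
Context {R : realType} {d : nat}.
Context {dX : measure_display} {Xi : measurableType dX}.
Context {dO : measure_display} {Om : measurableType dO}.
Variables (f : 'rV[R]_d -> R) (fstar L0 L1 : R) (D : probability Xi R)
  (g : 'rV[R]_d -> Xi -> 'rV[R]_d) (kappa : R) (sigma : 'rV[R]_d)
  (x1 : 'rV[R]_d) (eps : R) (T : nat)
  (P : probability Om R) (xi : nat -> Om -> Xi).
Hypothesis d_gt0 : (0 < d)%N.
Hypothesis f_ge : forall x, fstar <= f x.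
Hypothesis smooth_f : L0L1_smooth L0 L1 f.
Hypothesis kappa_bounds : 1 < kappa <= 2.
Hypothesis sigma_ge0 : forall i, 0 <= sigma 0 i.
Hypothesis noisy : heavy_tailed_estimates D f g kappa sigma.
Hypothesis iid : iid_samples P D T xi.
Hypotheses (eps_gt0 : 0 < eps) (T_gt0 : (0 < T)%N).

Let L0_ge0 : 0 <= L0. Proof. by case: smooth_f. Qed.
Let L1_ge0 : 0 <= L1. Proof. by case: smooth_f. Qed.
Let D0 : 0 < d%:R :> R. Proof. by rewrite ltr0n. Qed.
Let T0 : 0 < T%:R :> R. Proof. by rewrite ltr0n. Qed.

Local Notation mean b gamma :=
  (mean_grad_norm P f g x1 (fun=> b) (fun=> gamma) xi T).
Local Notation state b gamma k w :=
  (msignsgd_state g x1 (fun=> b) (fun=> gamma) (fun j => xi j w) k).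

Lemma mean_grad_normE (b gamma : R) :
  mean b gamma = ((T%:R^-1)%:E *
    \sum_(k < T) \int[P]_w (norm1 (grad f (state b gamma k w).1))%:E)%E.
Proof.
rewrite /mean_grad_norm big_add1/= big_mkord; congr (_ * _)%E.
by apply: eq_bigr => k _; rewrite unlock; apply: eq_integral => w _;
  rewrite lp_norm1E.
Qed.

Lemma mean_grad_norm_le (b gamma : R) (M : R) :
  ((\sum_(k < T) \int[P]_w (norm1 (grad f (state b gamma k w).1))%:E)
    <= (T%:R * M)%:E)%E -> (mean b gamma <= M%:E)%E.
Proof.
move=> H; rewrite mean_grad_normE.
apply: le_trans (lee_wpmul2l _ H) _; first by rewrite lee_fin invr_ge0 ltW.
by rewrite -EFinM lee_fin mulrA mulVf ?mul1r// gt_eqF.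
Qed.

(** For the degenerate tunings, whose stepsize vanishes. *)
Lemma mean_grad_norm_stationary (b : R) :
  norm1 (grad f x1) <= eps -> (mean b 0%R <= eps%:E)%E.
Proof.
move=> Geps; apply: mean_grad_norm_le.
have X1 k w : (state b 0 k w).1 = x1.
  by elim: k => // k IH; rewrite stateS_iterate IH scale0r subr0.
rewrite (eq_bigr (fun=> (norm1 (grad f x1))%:E)) => [|k _]; last first.
  under eq_integral do rewrite X1.
  by rewrite integral_cst//= probability_setT mule1.
rewrite sumEFin lee_fin sumr_const card_ord -[X in X <= _]mulr_natl.
by rewrite ler_wpM2l.
Qed.

(** In units of eps T, the 4/7 of [pathwise_bound] must cover 1/40 from the initial gap, 2 (1/18 +
    28/2500) from the initial gradient, 24/7 * 1/24 = 1/7 from smoothness and 2 * 1/8 from the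
    noise, about 0.552 in total. *)
Lemma mean_grad_norm_tuned (b gamma lam : R) :
  0 <= b -> b < 1 -> 0 < gamma -> 0 <= lam ->
  gamma * d%:R * L1 <= (1 - b) / 8 ->
  (f x1 - fstar) / gamma <= eps / 40 * T%:R ->
  gamma * d%:R / (1 - b) * L0 <= eps / 24 ->
  norm1 (grad f x1) <= eps * (18^-1 + 28 * lam) ->
  lam / (1 - b) <= T%:R / (50 * 50) ->
  ((1 - b) * (Num.sqrt d%:R * lp_norm kappa sigma / eps)) `^ kappa
    <= (1 - b) * (64^-1) `^ kappa ->
  (mean b gamma <= eps%:E)%E.
Proof.
move=> b0 b1 g0 lam0 gL Dg gL0 G1 lamT small; apply: mean_grad_norm_le.
have alpha0 : 0 < 1 - b by rewrite subr_gt0.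
pose a k w := norm1 (grad f (state b gamma k w).1).
pose n k w := norm1 (noise_average f g x1 b gamma (fun j => xi j w) k.+1).
have mst k : (k <= T)%N -> _ := fun kT => measurable_state_iid x1 b gamma noisy
  iid kT.
have ma (k : 'I_T) : measurable_fun setT (a k).
  have [fX _ _] := mst k (ltnW (ltn_ord k)).
  apply: (measurable_select (h := fun x _ => norm1 (grad f x)) fX) => x.
  exact: measurable_cst.
have mn (k : 'I_T) : measurable_fun setT (n k).
  have [_ _ mN] := mst k.+1 (ltn_ord k).
  rewrite (_ : n k = fun w => \sum_i
    `|noise_average f g x1 b gamma (fun j => xi j w) k.+1 0 i|); last first.
    by apply/funext => w; rewrite /n norm1E.
  by apply: measurable_sum => i; exact: measurableT_comp (mN i).
pose A0 := (f x1 - fstar) / gamma + 2 * norm1 (grad f x1) * \sum_(k < T) b ^+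
  k.+1
    + 24 / 7 * (gamma * d%:R / (1 - b) * L0) * T%:R.
have B0 : 0 <= \sum_(k < T) b ^+ k.+1 by apply: sumr_ge0 => k _;
  exact: exprn_ge0.
have A00 : 0 <= A0.
  rewrite /A0 !addr_ge0//.
  - by rewrite divr_ge0 ?(ltW g0)// subr_ge0.
  - by rewrite !mulr_ge0// norm1_ge0.
  - by rewrite !mulr_ge0// ?invr_ge0 ?(ltW alpha0)// ltW.
have path w : 4 / 7 * \sum_(k < T) a k w <= A0 + 2 * \sum_(k < T) n k w.
  exact: (pathwise_bound g x1 (fun j => xi j w) smooth_f f_ge b0 g0 T gL b1).
have En (k : 'I_T) : (\int[P]_w (n k w)%:E <= (8^-1 * eps)%:E)%E.
  (* [noise_level_le] with eta = 1/16 and rho = 1/64 <= eta / 2 gives 2 eta eps = eps / 8. *)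
  pose tau := 16^-1 * eps / d%:R.
  have tau0 : 0 < tau by rewrite divr_gt0// mulr_gt0.
  apply: le_trans (expected_noise_norm1 x1 gamma kappa_bounds noisy iid b0 b1
    tau0 _) _.
    exact: ltn_ord.
  rewrite lee_fin; apply: le_trans (noise_level_le d_gt0 kappa_bounds sigma_ge0
    eps_gt0 _ alpha0 _ _ small) _; lra.
have c47 : (0 < (4 / 7 : R)%:E)%E by rewrite lte_fin; lra.
rewrite -(lee_pmul2l _ c47)//.
have -> : ((4 / 7)%:E * \sum_(k < T) \int[P]_w (a k w)%:E =
    \int[P]_w (4 / 7 * \sum_(k < T) a k w)%:E)%E.
  rewrite -ge0_integral_sum//; last 2 first.
  - by move=> k; exact/measurable_EFinP.
  - by move=> k w _; rewrite lee_fin norm1_ge0.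
  rewrite -ge0_integralZl//.
  - by apply: eq_integral => w _; rewrite sumEFin -EFinM.
  - by apply: emeasurable_sum => k; exact/measurable_EFinP.
  - by move=> w _; rewrite sumEFin lee_fin sumr_ge0// => k _; exact: norm1_ge0.
apply: (@le_trans _ _ (\int[P]_w (A0%:E + 2%:E * \sum_(k < T) (n k w)%:E))%E).
  apply: ge0_le_integral => //.
  - move=> w _; rewrite lee_fin mulr_ge0// sumr_ge0// => k _; exact: norm1_ge0.
  - apply/measurable_EFinP; apply: measurable_funM => //.
    by apply: measurable_sum => k; exact: ma.
  - apply: emeasurable_funD => //; apply: measurable_funeM.
    by apply: emeasurable_sum => k; exact/measurable_EFinP.
  - by move=> w _; rewrite sumEFin -EFinM -EFinD lee_fin.
have sn0 w : (0 <= \sum_(k < T) (n k w)%:E)%E.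
  by rewrite sumEFin lee_fin sumr_ge0// => k _; exact: norm1_ge0.
have msn : measurable_fun setT (fun w => \sum_(k < T) (n k w)%:E)%E.
  by apply: emeasurable_sum => k; exact/measurable_EFinP.
rewrite ge0_integralD//; last 2 first.
- by move=> w _; rewrite mule_ge0.
- exact: measurable_funeM.
rewrite integral_cst//= probability_setT mule1 ge0_integralZl//.
rewrite ge0_integral_sum//; last 2 first.
- by move=> k; exact/measurable_EFinP.
- by move=> k w _; rewrite lee_fin norm1_ge0.
apply: (@le_trans _ _ (A0%:E + 2%:E * \sum_(k < T) (8^-1 * eps)%:E)%E).
  by rewrite leeD2l// lee_wpmul2l// lee_sum.
rewrite sumEFin -!EFinM -EFinD lee_fin sumr_const card_ord -[_ *+ T]mulr_natl.
have [BT Ba] := sum_geometric_le T alpha0 b0 (subrK b 1).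
have B1 : norm1 (grad f x1) * \sum_(k < T) b ^+ k.+1 <=
    eps * (18^-1 * T%:R + 28 * (T%:R / (50 * 50))).
  apply: le_trans (ler_wpM2r B0 G1) _; rewrite -mulrA;
    apply: ler_wpM2l (ltW eps_gt0) _ _ _.
  rewrite mulrDl; apply: lerD; first by rewrite ler_wpM2l// invr_ge0.
  rewrite -mulrA; apply: ler_wpM2l => //.
  by apply: le_trans (ler_wpM2l lam0 Ba) _.
have B2 := ler_wpM2r (ltW T0) gL0.
move: B1 B2 Dg; rewrite /A0; have := mulr_gt0 eps_gt0 T0.
have -> : 2 * norm1 (grad f x1) * \sum_(k < T) b ^+ k.+1 =
  2 * (norm1 (grad f x1) * \sum_(k < T) b ^+ k.+1) by rewrite mulrA.
have -> : 24 / 7 * (gamma * d%:R / (1 - b) * L0) * T%:R =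
  24 / 7 * (gamma * d%:R / (1 - b) * L0 * T%:R) by ring.
have -> : eps * (18^-1 * T%:R + 28 * (T%:R / (50 * 50))) =
  (18^-1 + 28 / (50 * 50)) * (eps * T%:R) by ring.
have -> : eps / 24 * T%:R = 24^-1 * (eps * T%:R) by ring.
have -> : eps / 40 * T%:R = 40^-1 * (eps * T%:R) by ring.
have -> : T%:R * (8^-1 * eps) = 8^-1 * (eps * T%:R) by ring.
have -> : T%:R * eps = eps * T%:R by ring.
move: (eps * T%:R) (norm1 _ * _) (gamma * d%:R / _ * _ * _) (_ / gamma).
by move=> *; lra.
Qed.

(** * The two regimes of the tuning *)

Section Tuning.
Local Notation Delta := (f x1 - fstar).
Local Notation S := (lp_norm kappa sigma).
Local Notation s := (Num.sqrt d%:R * S / eps).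
Local Notation q := (kappa / (kappa - 1)).
Hypothesis enough_iterations :
  iteration_bound (64 ^+ 2) Delta L0 L1 eps sigma kappa <= T%:R.

Let Delta_ge0 : 0 <= Delta. Proof. by rewrite subr_ge0. Qed.
Let S_ge0 : 0 <= S. Proof. exact: powR_ge0. Qed.
Let s_ge0 : 0 <= s.
Proof. by rewrite divr_ge0 ?(ltW eps_gt0)// mulr_ge0// sqrtr_ge0. Qed.
Let sqd_gt0 : 0 < Num.sqrt d%:R :> R. Proof. by rewrite sqrtr_gt0. Qed.
Let s_eq0 : (s == 0) = (S == 0).
Proof. by rewrite !mulf_eq0 invr_eq0 (gt_eqF eps_gt0) (gt_eqF sqd_gt0) orbF.
  Qed.

(** Each regime keeps only one of the two leading terms as [lam] and drops the other. *)
Lemma iteration_bound_part (lam lam' : R) : 0 <= lam' ->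
  lam + lam' = Delta * L0 * d%:R / eps ^+ 2 + Delta * L1 * d%:R / eps ->
  64 ^+ 2 * (lam / T%:R) * (1 + (64 ^+ 2 * s) `^ q) <= 1.
Proof.
move=> lam'0 lamE; move: enough_iterations; rewrite /iteration_bound -lamE.
set K := 1 + (_ `^ _); have K0 : 0 <= K by rewrite addr_ge0// powR_ge0.
move=> H; have -> : 64 ^+ 2 * (lam / T%:R) * K = 64 ^+ 2 * lam * K / T%:R by
  ring.
rewrite ler_pdivrMr// mul1r; apply: le_trans H; rewrite ler_wpM2r// ler_wpM2l//.
by rewrite lerDl.
Qed.

Lemma tuning_large : 0 < L1 -> 3 * L0 / L1 <= eps ->
  forall b, b = beta_large Delta L1 sigma kappa T ->
  (mean b (gamma_large d b L1) <= eps%:E)%E.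
Proof.
move=> L10 L0eps b bdef.
pose alpha := capped_ratio (Delta * L1 * Num.sqrt d%:R) (T%:R * S)
  (kappa / (2 * kappa - 1)).
have bA : b = 1 - alpha by exact: bdef.
have bE : 1 - b = alpha by rewrite bA subKr.
have alpha1 : alpha <= 1 by exact: capped_ratio_le1.
have alpha0 : 0 <= alpha by exact: capped_ratio_ge0.
have L0L1 : L0 / L1 <= eps / 3 by lra.
have L1d0 : 0 < L1 * d%:R by exact: mulr_gt0.
pose lam := Delta * L1 * d%:R / eps.
have lam0 : 0 <= lam by rewrite divr_ge0 ?(ltW eps_gt0)// !mulr_ge0.
(* A virtual step of size 1 / (24 L1 d) gives 7/6 * 24 = 28 in front of [lam]; its L0 part is at
   most eps / 54. *)
have G1 : norm1 (grad f x1) <= eps * (18^-1 + 28 * lam).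
  have gam0 : 0 < (24 * (L1 * d%:R))^-1 by rewrite invr_gt0 mulr_gt0.
  apply: le_trans (grad_norm1_le smooth_f x1 f_ge gam0 _) _.
    have -> : (24 * (L1 * d%:R))^-1 * L1 * d%:R = 24^-1.
      by field; rewrite !gt_eqF.
    lra.
  have -> : Delta / (24 * (L1 * d%:R))^-1 = 24 * (eps * lam).
    by rewrite /lam invrK; field; rewrite gt_eqF.
  have -> : L0 * (d%:R * (24 * (L1 * d%:R))^-1) = 24^-1 * (L0 / L1).
    by field; rewrite !gt_eqF.
  by move: (L0 / L1) L0L1 => r H; move: eps_gt0; lra.
(* alpha = 0 is possible only if Delta = 0; the stepsize is then 0, and the bound on the initial
   gradient suffices. *)
have [alphaZ|alphaN0] := eqVneq alpha 0.
  rewrite /gamma_large bE alphaZ !mul0r; apply: mean_grad_norm_stationary.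
  have Delta0 : Delta = 0.
    apply/eqP; rewrite eq_le Delta_ge0 andbT leNgt; apply/negP => Delta0.
    have : 0 < alpha by apply: capped_ratio_gt0; rewrite ?mulr_gt0// mulr_ge0.
    by rewrite alphaZ ltxx.
  apply: le_trans G1 _; rewrite /lam Delta0 !mul0r mulr0 addr0.
  by rewrite ler_piMr ?(ltW eps_gt0)//; lra.
have {}alpha0 : 0 < alpha by rewrite lt_neqAle eq_sym alphaN0.
have [|||||F1 F2] := @capped_ratio_large_bounds R kappa 64 (lam / T%:R) s
  kappa_bounds
    _ _ s_ge0 _ (Delta * L1 * Num.sqrt d%:R) (T%:R * S) _ _ alpha0.
- by rewrite ler1n.
- by rewrite divr_ge0 ?(ltW T0).
- apply: (@iteration_bound_part lam (Delta * L0 * d%:R / eps ^+ 2)).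
    by rewrite divr_ge0 ?exprn_ge0 ?(ltW eps_gt0)// !mulr_ge0.
  by rewrite addrC.
- by rewrite s_eq0 mulf_eq0 (gt_eqF T0).
- have [->|SN0] := eqVneq S 0; first by rewrite !(mulr0, mul0r, invr0).
  rewrite /lam -[X in _ * X / eps]sqrt_dim; field.
  by rewrite !gt_eqF// lt_neqAle eq_sym SN0.
have lamalpha : lam / alpha <= T%:R / 64 ^+ 2.
  move: F1; rewrite mulrAC ler_pdivrMr// => /le_trans; apply.
  by rewrite mulrC.
apply: (mean_grad_norm_tuned (lam := lam)); rewrite ?bE//.
- by rewrite bA subr_ge0.
- by rewrite bA ltrBlDr ltrDl.
- by rewrite /gamma_large bE mulr_gt0 ?invr_gt0// divr_gt0.
- rewrite /gamma_large bE le_eqVlt; apply/orP; left; apply/eqP.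
  by field; rewrite !gt_eqF.
- have -> : Delta / gamma_large d b L1 = 8 * eps * (lam / alpha).
    by rewrite /gamma_large bE /lam; field; rewrite !gt_eqF.
  apply: le_trans (ler_wpM2l _ lamalpha) _;
    first by rewrite mulr_ge0 ?(ltW eps_gt0).
  by have := mulr_gt0 eps_gt0 T0; lra.
- have -> : gamma_large d b L1 * d%:R / alpha * L0 = 8^-1 * (L0 / L1).
    by rewrite /gamma_large bE; field; rewrite !gt_eqF.
  by lra.
- by apply: le_trans lamalpha _; move: T0; lra.
Qed.

Lemma tuning_small : (0 < L1 -> eps <= 3 * L0 / L1) ->
  forall b, b = beta_small Delta L0 sigma kappa T ->
  (mean b (gamma_small d Delta b L0 T) <= eps%:E)%E.
Proof.
move=> epsL b bdef.
pose alpha := capped_ratio (Delta * L0) (T%:R * S ^+ 2)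
  (kappa / (3 * kappa - 2)).
have bA : b = 1 - alpha by exact: bdef.
have bE : 1 - b = alpha by rewrite bA subKr.
have alpha1 : alpha <= 1 by exact: capped_ratio_le1.
(* Multiplied out, the regime condition also covers L1 = 0, where the threshold 3 L0 / L1 is read as
   infinite. *)
have L1eps : L1 * eps <= 3 * L0.
  have [L10|L10] := ltP 0 L1.
    by move: (epsL L10); rewrite ler_pdivlMr// mulrC.
  by rewrite (le_trans (mulr_le0_ge0 L10 (ltW eps_gt0)))// mulr_ge0.
have [L0Z|L0N0] := eqVneq L0 0.
  have L1Z : L1 = 0.
    apply/eqP; rewrite eq_le L1_ge0 andbT -(ler_pM2r eps_gt0) mul0r.
    by move: L1eps; rewrite L0Z mulr0.
  have -> : gamma_small d Delta b L0 T = 0.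
    by rewrite /gamma_small L0Z mulr0 mul0r invr0 mulr0 sqrtr0.
  apply: mean_grad_norm_stationary.
  (* Since L0 = L1 = 0, the virtual step may be arbitrarily long; this length brings 7/6 Delta / G
     below eps. *)
  pose G := 7 / 6 * Delta / eps + 1.
  have gam0 : 0 < G.
    by apply: ltr_wpDl => //; rewrite divr_ge0 ?(ltW eps_gt0)// mulr_ge0.
  have epsG : eps * G = 7 / 6 * Delta + eps by rewrite /G; field;
    rewrite gt_eqF.
  apply: le_trans (grad_norm1_le smooth_f x1 f_ge gam0 _) _.
    by rewrite L1Z mulr0 mul0r invr_ge0.
  rewrite L0Z mul0r mulr0 addr0; move: (G) gam0 epsG => G' gam0 epsG.
  by rewrite mulrA ler_pdivrMr// epsG lerDl ltW.
have L00 : 0 < L0 by rewrite lt_neqAle eq_sym L0N0.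
have L0d0 : 0 < L0 * d%:R by exact: mulr_gt0.
pose lam := Delta * L0 * d%:R / eps ^+ 2.
have eps2 : 0 < eps ^+ 2 by exact: exprn_gt0.
have lam0 : 0 <= lam by rewrite divr_ge0 ?(ltW eps2)// !mulr_ge0.
(* A virtual step of size eps / (24 L0 d) is admissible because L1 eps <= 3 L0. Its L0 part is 7/6 *
   8/7 * eps / 24 = eps / 18, and 28 arises as in the other regime. *)
have G1 : norm1 (grad f x1) <= eps * (18^-1 + 28 * lam).
  have gam0 : 0 < eps / (24 * (L0 * d%:R)) by rewrite divr_gt0// mulr_gt0.
  apply: le_trans (grad_norm1_le smooth_f x1 f_ge gam0 _) _.
    have -> : eps / (24 * (L0 * d%:R)) * L1 * d%:R = L1 * eps / (24 * L0).
      by field; rewrite !gt_eqF.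
    by rewrite ler_pdivrMr ?mulr_gt0//; lra.
  have -> : Delta / (eps / (24 * (L0 * d%:R))) = 24 * (eps * lam).
    by rewrite /lam; field; rewrite !gt_eqF.
  have -> : L0 * (d%:R * (eps / (24 * (L0 * d%:R)))) = 24^-1 * eps.
    by field; rewrite !gt_eqF.
  by lra.
have [DeltaZ|DeltaN0] := eqVneq Delta 0.
  have -> : gamma_small d Delta b L0 T = 0.
    by rewrite /gamma_small DeltaZ !mul0r sqrtr0.
  apply: mean_grad_norm_stationary.
  apply: le_trans G1 _; rewrite /lam DeltaZ !mul0r mulr0 addr0.
  by rewrite ler_piMr ?(ltW eps_gt0)//; lra.
have Delta0 : 0 < Delta by rewrite lt_neqAle eq_sym DeltaN0 Delta_ge0.
have alpha0 : 0 < alpha.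
  by apply: capped_ratio_gt0; rewrite ?mulr_gt0// mulr_ge0// sqr_ge0.
have [|||||F1 F2] := @capped_ratio_small_bounds R kappa 64 (lam / T%:R) s
  kappa_bounds
    _ _ s_ge0 _ (Delta * L0) (T%:R * S ^+ 2) _ _ alpha0.
- by rewrite ler1n.
- by rewrite divr_ge0 ?(ltW T0).
- apply: (@iteration_bound_part lam (Delta * L1 * d%:R / eps)) => //.
  by rewrite divr_ge0 ?(ltW eps_gt0)// !mulr_ge0.
- by rewrite s_eq0 mulf_eq0 (gt_eqF T0) expf_eq0.
- have [->|SN0] := eqVneq S 0; first by rewrite !(mulr0, mul0r, expr0n, invr0).
  have -> : s ^+ 2 = d%:R * S ^+ 2 / eps ^+ 2.
    by rewrite !exprMn exprVn sqr_sqrtr.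
  rewrite /lam; field.
  by rewrite !gt_eqF// lt_neqAle eq_sym SN0.
set gam := gamma_small d Delta b L0 T.
have gam2 : gam ^+ 2 = Delta * alpha / (T%:R * L0 * d%:R).
  by rewrite sqr_sqrtr bE// divr_ge0 ?mulr_ge0// ltW.
have gam0 : 0 < gam by rewrite sqrtr_gt0 bE divr_gt0 ?mulr_gt0.
(* The stepsize is a square root, so squares are compared: the square of the left side is eps^2 lam
   / (T alpha), and c^-2 becomes c^-1. *)
have gamL0 : gam * d%:R / alpha * L0 <= eps / 64.
  have lhs0 : 0 <= gam * d%:R / alpha * L0.
    by rewrite mulr_ge0// divr_ge0 ?(ltW alpha0)// mulr_ge0 ?(ltW gam0).
  have rhs0 : 0 <= eps / 64 by rewrite divr_ge0// ltW.
  rewrite -ler_sqr//.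
  have -> : (gam * d%:R / alpha * L0) ^+ 2 = eps ^+ 2 * (lam / T%:R / alpha).
    rewrite !exprMn gam2 exprVn /lam; field.
    by rewrite !gt_eqF.
  by rewrite exprMn exprVn; apply: (ler_wpM2l _ F1); exact: ltW.
have lamalpha : lam / alpha <= T%:R / 64 ^+ 2.
  move: F1; rewrite mulrAC ler_pdivrMr// => /le_trans; apply.
  by rewrite mulrC.
apply: (mean_grad_norm_tuned (lam := lam)); rewrite ?bE//.
- by rewrite bA subr_ge0.
- by rewrite bA ltrBlDr ltrDl.
- have H : gam * d%:R * L0 <= alpha * (eps / 64).
    by rewrite [leRHS]mulrC -ler_pdivrMr// mulrAC.
  rewrite -(ler_pM2r eps_gt0).
  have -> : gam * d%:R * L1 * eps = gam * d%:R * (L1 * eps) by rewrite mulrA.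
  have gd0 : 0 <= gam * d%:R by rewrite mulr_ge0// ltW.
  apply: le_trans (ler_wpM2l gd0 L1eps) _.
  have := mulr_gt0 alpha0 eps_gt0; lra.
- have lhs0 : 0 <= Delta / gam by rewrite divr_ge0// ltW.
  have rhs0 : 0 <= eps / 40 * T%:R by rewrite mulr_ge0// divr_ge0// ltW.
  rewrite -ler_sqr//.
  have -> : (Delta / gam) ^+ 2 = eps ^+ 2 * T%:R * (lam / alpha).
    rewrite !exprMn exprVn gam2 /lam; field.
    by rewrite !gt_eqF.
  apply: le_trans (ler_wpM2l _ lamalpha) _; first by rewrite mulr_ge0// ltW.
  have := mulr_gt0 eps2 (exprn_gt0 2 T0).
  have -> : (eps / 40 * T%:R) ^+ 2 = (40 * 40)^-1 * (eps ^+ 2 * T%:R ^+ 2) by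
    field.
  have -> : eps ^+ 2 * T%:R * (T%:R / 64 ^+ 2) = (64 ^+ 2)^-1 * (eps ^+ 2 *
    T%:R ^+ 2).
    by field.
  by move: (eps ^+ 2 * _) => w; lra.
- by apply: le_trans gamL0 _; move: eps_gt0; lra.
- by apply: le_trans lamalpha _; move: T0; lra.
Qed.

End Tuning.
End MeanGradient.

Theorem theorem3 (R : realType) :
  exists2 C : R, 0 < C &
  forall (d : nat) (f : 'rV[R]_d -> R) (fstar L0 L1 : R)
    (dX : measure_display) (Xi : measurableType dX) (D : probability Xi R)
    (g : 'rV[R]_d -> Xi -> 'rV[R]_d) (kappa : R) (sigma : 'rV[R]_d)
    (x1 : 'rV[R]_d) (eps : R) (T : nat)
    (dO : measure_display) (Om : measurableType dO) (P : probability Om R)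
    (xi : nat -> Om -> Xi),
  (0 < d)%N ->
  (forall x, fstar <= f x) ->
  L0L1_smooth L0 L1 f ->
  1 < kappa <= 2 ->
  (forall i, 0 <= sigma 0 i) ->
  heavy_tailed_estimates D f g kappa sigma ->
  iid_samples P D T xi ->
  0 < eps ->
  (0 < T)%N ->
  let Delta := f x1 - fstar in
  iteration_bound C Delta L0 L1 eps sigma kappa <= T%:R ->
  (0 < L1 -> 3 * L0 / L1 <= eps ->
     let beta := beta_large Delta L1 sigma kappa T in
     let gamma := gamma_large d beta L1 in
     (mean_grad_norm P f g x1 (fun=> beta) (fun=> gamma) xi T <= eps%:E)%E) /\
  ((0 < L1 -> eps <= 3 * L0 / L1) ->
     let beta := beta_small Delta L0 sigma kappa T in
     let gamma := gamma_small d Delta beta L0 T in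
     (mean_grad_norm P f g x1 (fun=> beta) (fun=> gamma) xi T <= eps%:E)%E).
Proof.
(* This is c^2 with c = 64: the noise needs 1 / c <= 1/32, and c^-2 leaves c^-1 for the square root
   stepsizes. *)
exists (64 ^+ 2) => // d f fstar L0 L1 dX Xi D g kappa sigma x1 eps T dO Om P xi.
move=> d0 f_ge smooth_f kappa_bounds sigma0 noisy iid eps0 T0 Delta enough.
split=> [L10 epsL|epsL].
  exact: (tuning_large d0 f_ge smooth_f kappa_bounds sigma0 noisy iid eps0 T0
    enough L10 epsL erefl).
exact: (tuning_small d0 f_ge smooth_f kappa_bounds sigma0 noisy iid eps0 T0
  enough epsL erefl).
Qed.
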